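(* Let $n\ge 2$ and $u,w\in S_n$. Then, in the nilCoxeter algebra, $$\sum_{v\in S_n}c_{uv}^w\,e_v=\sum_{\{v_i^{(s)}\}}\ \prod_{s=1}^{n-1}\ \prod_{i=1}^{n-s}e_i^{(s)}\left(v_{i-1}^{(s)}/v_i^{(s)}\right),$$ where the sum on the right is over all families $(v_i^{(s)})_{1\le s\le n-1,\ 0\le i\le n-s}$ of permutations in $S_n$ such that $$v_0^{(1)}=w,\qquad v_0^{(s+1)}=v_{n-s}^{(s)}\ (1\le s\le n-2),\qquad v_1^{(n-1)}=u,$$ and, for all $1\le s\le n-1$ and $1\le i\le n-s$, $$v_{i-1}^{(s)}\succeq v_i^{(s)}\quad\text{and}\quad l(v_{i-1}^{(s)})-l(v_i^{(s)})\le 1.$$ In the products the factors are multiplied from left to right in order of increasing $s$ and, for fixed $s$, in order of increasing $i$.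
   Context: $S_n$ is the symmetric group on $\{1,\dots,n\}$ with product $(vw)(k)=v(w(k))$, $l$ is the length, $s_a=(a,a+1)$, $t_{(a,b)}$ is the transposition interchanging $a$ and $b$, and $w\succeq v$ means that $w$ dominates $v$ (possibly $w=v$) in the Bruhat order: some (equivalently every) reduced decomposition of $w$ contains a subsequence that is a reduced decomposition of $v$. Schubert polynomials: let $P_n=\mathbf{Z}[x_1,\dots,x_n]$, and for $1\le a\le n-1$ let $\partial_a f=(f-s_af)/(x_a-x_{a+1})$, where $s_a$ interchanges $x_a$ and $x_{a+1}$. For $w\in S_n$, $\partial_w=\partial_{a_1}\cdots\partial_{a_p}$ for any reduced decomposition $w=s_{a_1}\cdots s_{a_p}$ (independent of the choice). Then $\mathfrak{S}_w=\partial_{w^{-1}w_0}(x_1^{n-1}x_2^{n-2}\cdots x_{n-1})$, where $w_0$ is the longest element of $S_n$. Structural constants: let $I_n\subset P_n$ be the ideal generated by the symmetric polynomials without constant term. The classes of $\mathfrak{S}_w$, $w\in S_n$, form a $\mathbf{Z}$-basis of $P_n/I_n$, and the integers $c_{uv}^w$ are defined by $$\mathfrak{S}_u\mathfrak{S}_v\equiv\sum_{w\in S_n}c_{uv}^w\,\mathfrak{S}_w\pmod{I_n}.$$ NilCoxeter algebra: $NC_n$ is the associative unital $\mathbf{Z}$-algebra with generators $e_1,\dots,e_n$ and relations $e_i^2=0$; $e_ie_j=e_je_i$ if $|i-j|>1$; $e_ie_je_i=e_je_ie_j$ if $|i-j|=1$. For $v\in S_{n+1}$ (in particular for $v\in S_n\subset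 S_{n+1}$), $e_v=e_{a_1}\cdots e_{a_p}$ for any reduced decomposition $v=s_{a_1}\cdots s_{a_p}$; the $e_v$, $v\in S_{n+1}$, are well defined and form a $\mathbf{Z}$-basis of $NC_n$. The elements $e_i^{(s)}(w/v)$: for $w,v\in S_n$ with $w\succeq v$ and $l(w)-l(v)\le 1$ (so that either $w=v$ or $w=vt_{(a,b)}$ for a transposition $t_{(a,b)}$), and for $1\le i\le n-1$, $1\le s\le n-1$, define $e_i^{(s)}(w/v)\in NC_n$ by - $e_i^{(s)}(w/v)=1$ if $w=v$; - $e_i^{(s)}(w/v)=e_{n-i}$ if $w=vt_{(s,b)}$ with $s<b$; - $e_i^{(s)}(w/v)=-e_{n-i}$ if $w=vt_{(b,s)}$ with $b<s$; - $e_i^{(s)}(w/v)=0$ if $w=vt_{(a,b)}$ with $a\ne s$ and $b\ne s$. *)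

(* Defs.v *)
From HB Require Import structures.
From mathcomp Require Import all_boot all_order all_fingroup all_algebra.
From mathcomp Require Import generic_quotient ring_quotient.
From mathcomp Require Import boolp classical_sets.
From mathcomp Require monalg.
From mathcomp Require Import mpoly.
Import -(notations) monalg.

Set Implicit Arguments.
Unset Strict Implicit.
Unset Printing Implicit Defensive.

Import Order.TTheory GRing.Theory Num.Theory.
Local Open Scope ring_scope.
Local Open Scope quotient_scope.

(* The point k of {1, ..., n} is the ordinal of value k - 1 in 'I_n.          *)

Declare Scope sym_scope.
Delimit Scope sym_scope with sym.

(* (v ** w)(k) = v (w k), whereas MathComp's (v * w)%g applies v first.       *)
Notation "v ** w" := (w * v)%g (at level 40, left associativity) : sym_scope.

Lemma adj_proof n (a : 'I_n.-1) : (a.+1 < n)%N.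
Proof. by case: n a => [|n] [a]. Qed.

Definition adj_lo n (a : 'I_n.-1) : 'I_n := Ordinal (ltnW (adj_proof a)).
Definition adj_hi n (a : 'I_n.-1) : 'I_n := Ordinal (adj_proof a).

Definition simple n (a : 'I_n.-1) : 'S_n := tperm (adj_lo a) (adj_hi a).

Definition word_perm n (r : seq 'I_n.-1) : 'S_n :=
  foldr (fun a v => (simple a ** v)%sym) 1%g r.

Lemma word_perm_cat n (r r' : seq 'I_n.-1) :
  word_perm (r ++ r') = (word_perm r ** word_perm r')%sym.
Proof. by elim: r => [|a r IHr] /=; rewrite ?mulg1 // IHr mulgA. Qed.

Lemma exists_word_tperm n (i j : 'I_n) :
  exists r : seq 'I_n.-1, word_perm r = tperm i j.
Proof.
wlog le_ij : i j / (i <= j)%N.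
  move=> H; case/orP: (leq_total i j) => [|/H]; first exact: H.
  by rewrite tpermC.
move: {2}(j - i)%N (erefl (j - i)%N) => d; elim: d j le_ij => [|d IHd] j le_ij.
  move/eqP; rewrite subn_eq0 => le_ji; exists [::].
  have -> : j = i by apply/val_inj/anti_leq; rewrite le_ij le_ji.
  by rewrite tperm1.
move=> jiE; have lt_ij : (i < j)%N by rewrite -subn_gt0 jiE.
have j_gt0 : (0 < j)%N by apply: leq_ltn_trans lt_ij.
have lt_j'n : (j.-1 < n.-1)%N by rewrite -ltnS !prednK //; case: (n) j {le_ij jiE lt_ij j_gt0} => [[]|].
pose a := Ordinal lt_j'n.
have hiE : adj_hi a = j by apply: val_inj; rewrite /= prednK.
have [|| r rE] := IHd (adj_lo a).
- by rewrite /= -ltnS prednK.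
- by rewrite /= -subn1 subnAC jiE subn1.
case: (eqVneq i (adj_lo a)) => [iE|neq_i].
  by exists [:: a]; rewrite /= mul1g /simple -iE hiE.
exists ([:: a] ++ r ++ [:: a]); rewrite !word_perm_cat rE /= !mul1g.
rewrite {2}/simple -[X in (X * _ * _)%g]tpermV -mulgA.
rewrite -/(conjg (tperm i (adj_lo a)) (tperm (adj_lo a) (adj_hi a))) tpermJ tpermL.
rewrite tpermD ?hiE // 1?eq_sym //.
by apply/eqP => ij; rewrite ij ltnn in lt_ij.
Qed.

Lemma exists_word n (v : 'S_n) : exists r : seq 'I_n.-1, word_perm r = v.
Proof.
have [ts -> _] := prod_tpermP v.
elim: ts => [|t ts [r rE]]; first by exists [::]; rewrite big_nil.
have [r' r'E] := exists_word_tperm t.1 t.2.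
by exists (r ++ r'); rewrite word_perm_cat big_cons rE r'E.
Qed.

Lemma exists_word_size n (v : 'S_n) :
  exists p, [exists r : p.-tuple 'I_n.-1, word_perm r == v].
Proof.
have [r rE] := exists_word v; exists (size r).
by apply/existsP; exists (in_tuple r); rewrite rE.
Qed.

Definition len n (v : 'S_n) : nat := ex_minn (exists_word_size v).

Lemma exists_reduced n (v : 'S_n) :
  exists r : (len v).-tuple 'I_n.-1, word_perm r == v.
Proof. by rewrite /len; case: ex_minnP => p /existsP. Qed.

(* Some reduced decomposition; the operators and elements built from it below *)
(* do not depend on its choice.                                               *)
Definition redword n (v : 'S_n) : seq 'I_n.-1 := xchoose (exists_reduced v).

Definition bruhat_le n (v w : 'S_n) : bool :=
  [exists r : (len w).-tuple 'I_n.-1, exists r' : (len v).-tuple 'I_n.-1,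
     [&& word_perm r == w, word_perm r' == v & subseq r' r]].

Definition longest n : 'S_n := [arg max_(w > 1%g : 'S_n) len w].

(* For commutative A this is the ideal generated by S.                        *)
Definition in_ideal (A : pzRingType) (S : A -> Prop) (x : A) : Prop :=
  exists2 ts : seq (A * A * A), {in ts, forall t, S t.1.2} &
    x = \sum_(t <- ts) t.1.1 * t.1.2 * t.2.

Lemma exists_ddiff n (a : 'I_n.-1) (f : {mpoly int[n]}) :
  exists g : {mpoly int[n]},
    g * ('X_(adj_lo a) - 'X_(adj_hi a)) == f - msym (simple a) f.
Proof.
set d := _ - _; set s := simple a.
pose P f := exists g : {mpoly int[n]}, g * d == f - msym s f.
have P1 : P 1 by exists 0; rewrite rmorph1 subrr mul0r.
have PM f1 f2 : P f1 -> P f2 -> P (f1 * f2).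
  move=> [g1 /eqP e1] [g2 /eqP e2]; exists (f1 * g2 + g1 * msym s f2).
  rewrite mulrDl -mulrA e2 mulrAC e1 mulrBr mulrBl rmorphM /=.
  by rewrite addrA subrK.
have PX i : P 'X_i.
  rewrite /P /msym mmapX mmap1U /s /simple; case: tpermP => [->|->|_ _].
  - by exists 1; rewrite mul1r.
  - by exists (-1); rewrite mulN1r opprB.
  by exists 0; rewrite subrr mul0r.
have PXm m : P 'X_[m].
  rewrite mpolyXE_id; apply: (big_ind P) => // i _.
  by elim: (m i) => [|k IHk]; rewrite ?expr0 // exprS; apply: PM.
rewrite -/(P f) [f]mpolyE; apply: (big_ind P) => [|f1 f2 [g1 /eqP e1] [g2 /eqP e2]|m _].
- by exists 0; rewrite raddf0 subrr mul0r.
- by exists (g1 + g2); rewrite mulrDl e1 e2 raddfD opprD addrACA.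
have [g /eqP e] := PXm m.
by exists (f@_m *: g); rewrite -scalerAl e scalerBr msymZ.
Qed.

(* The polynomial g with (x_a - x_(a+1)) g = f - s_a f; it is unique since    *)
(* Z[x_1, ..., x_n] is a domain.                                              *)
Definition ddiff n (a : 'I_n.-1) (f : {mpoly int[n]}) : {mpoly int[n]} :=
  xchoose (exists_ddiff a f).

Lemma ddiffP n (a : 'I_n.-1) (f : {mpoly int[n]}) :
  ddiff a f * ('X_(adj_lo a) - 'X_(adj_hi a)) = f - msym (simple a) f.
Proof. exact/eqP/(xchooseP (exists_ddiff a f)). Qed.

Definition ddiff_perm n (w : 'S_n) (f : {mpoly int[n]}) : {mpoly int[n]} :=
  foldr (@ddiff n) f (redword w).

Definition schubert n (w : 'S_n) : {mpoly int[n]} :=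
  ddiff_perm (w^-1 ** longest n)%sym (\prod_(i < n) 'X_i ^+ (n.-1 - i)).

Definition sym_ideal n : {mpoly int[n]} -> Prop :=
  in_ideal (fun f => f \is symmetric /\ f@_0%MM = 0).

(* The coefficients are uniquely determined, the Schubert polynomials being a *)
(* basis of the quotient by sym_ideal; xget picks them out.                   *)
Definition struct_const n (u v w : 'S_n) : int :=
  xget 0 [set c : {ffun 'S_n -> int} |
    sym_ideal (schubert u * schubert v - \sum_(w' : 'S_n) c w' *: schubert w')]
  w.


Section QuotientRing.
Variables (A : pzRingType) (S : A -> Prop).

Lemma in_ideal0 : in_ideal S 0.
Proof. by exists [::]; rewrite ?big_nil. Qed.

Lemma in_idealB x y : in_ideal S x -> in_ideal S y -> in_ideal S (x - y).
Proof.
move=> [s sS ->] [t tS ->].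
exists (s ++ [seq (- p.1.1, p.1.2, p.2) | p <- t]).
  move=> p; rewrite mem_cat => /orP[/sS//|/mapP[q /tS qS ->]] //.
rewrite big_cat big_map /= -sumrN; congr (_ + _).
by apply: eq_bigr => p _; rewrite !mulNr.
Qed.

Lemma in_idealM a b x : in_ideal S x -> in_ideal S (a * x * b).
Proof.
move=> [s sS ->]; exists [seq (a * p.1.1, p.1.2, p.2 * b) | p <- s].
  by move=> p /mapP[q /sS qS ->].
rewrite big_map mulr_sumr mulr_suml; apply: eq_bigr => p _ /=.
by rewrite !mulrA.
Qed.

Definition ideal_pred : {pred A} := fun x => `[< in_ideal S x >].

Fact ideal_pred_zmod : zmod_closed ideal_pred.
Proof.
split; first exact/asboolP/in_ideal0.
by move=> x y /asboolP xI /asboolP yI; apply/asboolP/in_idealB.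
Qed.
HB.instance Definition _ := GRing.isZmodClosed.Build A ideal_pred ideal_pred_zmod.

(* The quotient of A by the two-sided ideal generated by S.                   *)
Definition quot_ring : Type := Quotient.quot ideal_pred.
HB.instance Definition _ := GRing.Zmodule.on quot_ring.

Definition quot_pi (x : A) : quot_ring := \pi_(Quotient.quot ideal_pred) x.

Lemma quot_piP x y : quot_pi x = quot_pi y <-> in_ideal S (x - y).
Proof.
split=> [/eqP|H]; first by rewrite /quot_pi -Quotient.idealrBE => /asboolP.
by apply/eqP; rewrite /quot_pi -Quotient.idealrBE; apply/asboolP.
Qed.

Definition quot_repr (x : quot_ring) : A := repr (x : Quotient.quot ideal_pred).

Lemma quot_reprK : cancel quot_repr quot_pi.
Proof. by move=> x; exact: (@reprK _ (Quotient.quot ideal_pred)). Qed.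

Lemma quot_piB : {morph quot_pi : x y / x - y}.
Proof. by move=> x y; rewrite /quot_pi raddfB. Qed.

Lemma quot_piD : {morph quot_pi : x y / x + y}.
Proof. by move=> x y; rewrite /quot_pi raddfD. Qed.

Definition quot_one : quot_ring := quot_pi 1.
Definition quot_mul (x y : quot_ring) : quot_ring :=
  quot_pi (quot_repr x * quot_repr y).

Lemma quot_piM : {morph quot_pi : x y / x * y >-> quot_mul x y}.
Proof.
move=> x y; apply/quot_piP.
set x' := quot_repr _; set y' := quot_repr _.
have xI : in_ideal S (x - x') by apply/quot_piP; rewrite quot_reprK.
have yI : in_ideal S (y' - y) by apply/quot_piP; rewrite quot_reprK.
have -> : x * y - x' * y' = 1 * (x - x') * y - x' * (y' - y) * 1.
  by rewrite mul1r mulr1 mulrBl mulrBr opprB addrA subrK.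
by apply: in_idealB; apply: in_idealM.
Qed.

Lemma quot_ind (P : quot_ring -> Prop) : (forall x, P (quot_pi x)) -> forall x, P x.
Proof. by move=> H x; rewrite -[x]quot_reprK. Qed.

Fact quot_mulA : associative quot_mul.
Proof.
by elim/quot_ind=> x; elim/quot_ind=> y; elim/quot_ind=> z; rewrite -!quot_piM mulrA.
Qed.
Fact quot_mul1l : left_id quot_one quot_mul.
Proof. by elim/quot_ind=> x; rewrite -quot_piM mul1r. Qed.
Fact quot_mul1r : right_id quot_one quot_mul.
Proof. by elim/quot_ind=> x; rewrite -quot_piM mulr1. Qed.
Fact quot_mulDl : left_distributive quot_mul +%R.
Proof.
elim/quot_ind=> x; elim/quot_ind=> y; elim/quot_ind=> z.
by rewrite -quot_piD -!quot_piM mulrDl quot_piD.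
Qed.
Fact quot_mulDr : right_distributive quot_mul +%R.
Proof.
elim/quot_ind=> x; elim/quot_ind=> y; elim/quot_ind=> z.
by rewrite -quot_piD -!quot_piM mulrDr quot_piD.
Qed.
HB.instance Definition _ := GRing.Zmodule_isPzRing.Build quot_ring
  quot_mulA quot_mul1l quot_mul1r quot_mulDl quot_mulDr.

Fact quot_pi_zmod_morphism : zmod_morphism quot_pi.
Proof. exact: quot_piB. Qed.
Fact quot_pi_monoid_morphism : monoid_morphism quot_pi.
Proof. by split; last exact: quot_piM. Qed.
HB.instance Definition _ :=
  GRing.isZmodMorphism.Build A quot_ring quot_pi quot_pi_zmod_morphism.
HB.instance Definition _ :=
  GRing.isMonoidMorphism.Build A quot_ring quot_pi quot_pi_monoid_morphism.

End QuotientRing.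

(* The free associative Z-algebra on 'I_n.                                    *)
Definition free_alg n := malg (fmonom 'I_n) int.
HB.instance Definition _ n := GRing.NzRing.on (free_alg n).

Definition free_gen n (i : 'I_n) : free_alg n := mkmalgU (fmu i) 1.

Variant nc_relator n : free_alg n -> Prop :=
| NcSquare (i : 'I_n) : nc_relator (free_gen i * free_gen i)
| NcCommute (i j : 'I_n) of (i.+1 < j)%N || (j.+1 < i)%N :
    nc_relator (free_gen i * free_gen j - free_gen j * free_gen i)
| NcBraid (i j : 'I_n) of (i.+1 == j)%N || (j.+1 == i)%N :
    nc_relator (free_gen i * free_gen j * free_gen i
                - free_gen j * free_gen i * free_gen j).

Definition nilcoxeter n := quot_ring (@nc_relator n).
HB.instance Definition _ n := GRing.PzRing.on (nilcoxeter n).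

(* nc_gen i is the generator of index i + 1.                                  *)
Definition nc_gen n (i : 'I_n) : nilcoxeter n := quot_pi _ (free_gen i).

(* The generator of index k, for k from 1 to n (and 0 outside this range).    *)
Definition nc_e n (k : nat) : nilcoxeter n :=
  if k is k'.+1 then oapp (@nc_gen n) 0 (insub k') else 0.

Definition nc_perm n (v : 'S_n.+1) : nilcoxeter n :=
  \prod_(a <- redword v) nc_gen a.

(* The inclusion of S_n in S_(n+1) as the stabilizer of the last point.       *)
Definition sym_incl n (v : 'S_n) : 'S_n.+1 := lift_perm ord_max ord_max v.

(* e_i^(s)(w/v), meant for w covering or equal to v; s and i are 1-based.     *)
Definition nc_step n (i s : nat) (w v : 'S_n) : nilcoxeter n :=
  if w == v then 1
  else if [exists a : 'I_n, exists b : 'I_n,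
             [&& a.+1 == s, (a < b)%N & w == (v ** tperm a b)%sym]]
  then nc_e n (n - i)
  else if [exists a : 'I_n, exists b : 'I_n,
             [&& a.+1 == s, (b < a)%N & w == (v ** tperm b a)%sym]]
  then - nc_e n (n - i)
  else 0.

Definition step_rel n (w v : 'S_n) : bool :=
  bruhat_le v w && (len w - len v <= 1)%N.

(* The pairs (s, i) with 1 <= s <= n - 1 and 0 <= i <= n - s.                 *)
Definition chain_index n :=
  {p : 'I_n * 'I_n | (0 < p.1)%N && (p.2 <= n - p.1)%N}.

Definition chain n := {ffun chain_index n -> 'S_n}.

(* The member of the family with upper index s and lower index i; the value 1 *)
(* taken outside the index set plays no role.                                 *)
Definition entry n (f : chain n) (s i : nat) : 'S_n :=
  if [pick p : chain_index n | (val p).1 == s :> nat & (val p).2 == i :> nat]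
  is Some p then f p else 1%g.

Definition admissible n (u w : 'S_n) (f : chain n) : bool :=
  [&& entry f 1 0 == w,
      [forall s : 'I_n, (1 <= s <= n - 2)%N ==>
         (entry f s.+1 0 == entry f s (n - s))],
      entry f n.-1 1 == u &
      [forall s : 'I_n, forall i : 'I_n, (1 <= s)%N && (1 <= i <= n - s)%N ==>
         step_rel (entry f s i.-1) (entry f s i)]].

(* Main.v *)
(* With e_1, ..., e_(n-1) acting on the right, the element
   \sum_v schubert v *: e_v factors as the product over s and i of the
   1 + x_s e_(n-i) (Fomin-Stanley): consecutive rows commute by the Yang-Baxter
   equation, so the divided difference by a of the product is the product times
   e_a, and the coefficient of the longest permutation is the staircase
   monomial.  Multiply by schubert u and expand one factor at a time with Monk's
   rule for x_s: the coefficient of schubert w is a sum over the chains from w to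
   u, and it is also \sum_v c_uv^w e_v.  Monk's rule modulo the ideal is checked
   on divided differences: a polynomial all of whose iterated divided differences
   have zero constant term lies in the ideal. *)
From HB Require Import structures.
Require Import Defs.
From mathcomp Require Import all_boot all_order all_fingroup all_algebra.
From mathcomp Require Import zify ring.
From mathcomp Require Import mpoly.
Import GRing.Theory.
Local Open Scope ring_scope.
Set Implicit Arguments.
Unset Strict Implicit.
Unset Printing Implicit Defensive.

(** * Inversions and strong exchange *)

(** Monk's rule for x_i holds only modulo the ideal, because the cover of v that exchanges i with n
    + 1 is missing from S_n. Coefficients are therefore read off by a functional that does not see
    the ideal: the constant term of the divided difference along w, which is 1 on [schubert w] and 0
    on the other Schubert polynomials. Every expansion modulo the ideal thus has the same
    coefficients. The nilCoxeter algebra enters through its relations. With polynomial coefficients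
    it is modelled by functions on S_n, where right multiplication by e_a sends f to the function
    equal to f(w s_a) at each w with a descent at a and to 0 elsewhere; divided differences act on
    Schubert polynomials by the same formula. The sum over families is a product of matrices over
    the nilCoxeter algebra, indexed by S_n, one for each pair (s, i) with i positive, so that it can
    be compared factor by factor with the factorization. *)

Section Coxeter.
Variable n : nat.
Implicit Types (v w : 'S_n) (a b : 'I_n.-1) (r : seq 'I_n.-1).

(** In [simple a * v] the factor [simple a] is applied first, so this product is v s_a: descents are
    right descents, read at adjacent positions of the one-line notation. *)
Definition desc v a := (v (adj_hi a) < v (adj_lo a))%N.

Definition inversions v := [set p : 'I_n * 'I_n | (p.1 < p.2)%N && (v p.2 < v p.1)%N].
Definition ninv v := #|inversions v|.

Lemma adj_neq a : (adj_lo a == adj_hi a) = false.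
Proof. by apply/eqP=> /(congr1 val) /=; lia. Qed.

Lemma simpleK a : involutive (simple a).
Proof. exact: tpermK. Qed.

Lemma simple_inj a : injective (simple a).
Proof. exact: perm_inj. Qed.

Lemma simple_lo a : simple a (adj_lo a) = adj_hi a.
Proof. exact: tpermL. Qed.
Lemma simple_hi a : simple a (adj_hi a) = adj_lo a.
Proof. exact: tpermR. Qed.

Lemma simple_mulK a v : (simple a * (simple a * v))%g = v.
Proof. by rewrite mulgA tperm2 mul1g. Qed.

Lemma simple_lt a (i j : 'I_n) : (i < j)%N -> ~~ ((i == adj_lo a) && (j == adj_hi a)) ->
  (simple a i < simple a j)%N.
Proof.
rewrite -!val_eqE /=; case: (tpermP _ _ i) => [->|->|/eqP + /eqP +];
  case: (tpermP _ _ j) => [->|->|/eqP + /eqP +]; rewrite -?val_eqE /=; lia.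
Qed.

Lemma desc_simple a v : desc (simple a * v)%g a = ~~ desc v a.
Proof.
rewrite /desc !permM simple_lo simple_hi -leqNgt ltn_neqAle andbC.
case: leqP => //= _; apply/negP => /eqP/val_inj/perm_inj/eqP.
by rewrite adj_neq.
Qed.

Lemma asc_lt a v : ~~ desc v a -> (v (adj_lo a) < v (adj_hi a))%N.
Proof. by rewrite -desc_simple /desc !permM simple_lo simple_hi. Qed.

(** Applying s_a to both members of a pair carries the inversions of v bijectively onto those of v
    s_a, apart from the new inversion at the two positions of a. *)
Lemma inv_asc a v : ~~ desc v a -> ninv (simple a * v)%g = (ninv v).+1.
Proof.
move=> asc; rewrite /ninv (cardsD1 (adj_lo a, adj_hi a)) !inE /=.
have := asc; rewrite -desc_simple /desc => -> /=; rewrite ltnSn /= add1n; congr S.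
rewrite -(card_imset (inversions v) (f := fun p => (simple a p.1, simple a p.2))); last first.
  by move=> [i j] [i' j'] [/simple_inj -> /simple_inj ->].
apply: eq_card => -[i j]; rewrite !inE /= xpair_eqE !permM.
apply/idP/imsetP => [/and3P[ne ij vij]|[[i' j']]].
  by exists (simple a i, simple a j); rewrite ?inE /= ?simpleK // simple_lt.
rewrite inE /= => /andP[ij vij] [-> ->]; rewrite !simpleK vij andbT.
have ne : ~~ ((i' == adj_lo a) && (j' == adj_hi a)).
  by apply: contra asc => /andP[/eqP e1 /eqP e2]; rewrite /desc -e1 -e2.
rewrite simple_lt // andbT; apply/negP => /andP[/eqP e1 /eqP e2].
move: ij; rewrite -[i'](simpleK a) -[j'](simpleK a) e1 e2 simple_lo simple_hi /=; lia.
Qed.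

Lemma inv_desc a v : desc v a -> ninv v = (ninv (simple a * v)%g).+1.
Proof. by move=> d; rewrite -{1}(simple_mulK a v) inv_asc // desc_simple d. Qed.

Lemma inv1 : ninv 1%g = 0%N.
Proof. by apply/eqP; rewrite cards_eq0; apply/eqP/setP => -[i j]; rewrite !inE !perm1 /=; case: ltngtP. Qed.

Lemma asc_mono v : (forall a, ~~ desc v a) -> forall i j : 'I_n, (i < j)%N -> (v i < v j)%N.
Proof.
move=> asc i j; move: {2}(nat_of_ord j) (erefl (nat_of_ord j)) => k; elim: k j => [|k IH] j jk ij; first lia.
have kn : (k < n.-1)%N by have := ltn_ord j; lia.
pose a := Ordinal kn.
have jE : j = adj_hi a by apply: val_inj.
have h : (v (adj_lo a) < v j)%N.
  have := asc a; rewrite /desc -jE -leqNgt leq_eqVlt => /orP[|//] /eqP/val_inj/perm_inj/eqP.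
  by rewrite jE adj_neq.
have [ik|/val_inj ->//] : (i < adj_lo a)%N \/ i = adj_lo a :> nat by move: ij; rewrite jE /=; lia.
exact: ltn_trans (IH (adj_lo a) erefl ik) h.
Qed.

Lemma mono_ge v : (forall i j : 'I_n, (i < j)%N -> (v i < v j)%N) -> forall i : 'I_n, (i <= v i)%N.
Proof.
move=> mono i; move: {2}(nat_of_ord i) (erefl (nat_of_ord i)) => k; elim: k i => [|k IH] i ik; first by rewrite ik.
have kn : (k < n)%N by have := ltn_ord i; lia.
have := IH (Ordinal kn) erefl; have := mono (Ordinal kn) i; rewrite /= ik => /(_ (ltnSn _)); lia.
Qed.

Lemma asc_id v : (forall a, ~~ desc v a) -> v = 1%g.
Proof.
move=> asc; have mono := asc_mono asc.
have mono' : forall i j : 'I_n, (i < j)%N -> ((v^-1)%g i < (v^-1)%g j)%N.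
  move=> i j ij; rewrite ltnNge leq_eqVlt; apply/negP => /orP[/eqP/val_inj/perm_inj e|/mono].
    by rewrite e ltnn in ij.
  by rewrite !permKV; lia.
apply/permP => i; rewrite perm1; apply/val_inj/anti_leq; rewrite (mono_ge mono) andbT.
by have := mono_ge mono' (v i); rewrite permK.
Qed.

Lemma exists_desc v : v != 1%g -> exists a, desc v a.
Proof.
move=> v1; case: (pickP (desc v)) => [a da|h]; first by exists a.
by case/eqP: v1; apply: asc_id => a; rewrite h.
Qed.

Lemma word_perm_rcons r a : word_perm (rcons r a) = (simple a * word_perm r)%g.
Proof. by rewrite -cats1 word_perm_cat /= mul1g. Qed.

Lemma inv_word_le r : (ninv (word_perm r) <= size r)%N.
Proof.
elim/last_ind: r => [|r a IH]; first by rewrite inv1.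
rewrite word_perm_rcons size_rcons; case: (boolP (desc (word_perm r) a)) => d.
  by have := inv_desc d; lia.
by rewrite inv_asc.
Qed.

Lemma exists_word_inv v : exists2 r, word_perm r = v & size r = ninv v.
Proof.
move: {2}(ninv v) (erefl (ninv v)) => k; elim: k v => [|k IH] v vk.
  exists [::]; rewrite ?vk //=; apply/esym/asc_id => a; apply/negP => /inv_desc; lia.
have [|a da] := @exists_desc v; first by apply: contra_eqN vk => /eqP ->; rewrite inv1.
have [|r rE rs] := IH (simple a * v)%g; first by have := inv_desc da; lia.
exists (rcons r a); first by rewrite word_perm_rcons rE simple_mulK.
by rewrite size_rcons rs -inv_desc.
Qed.

Lemma lenE v : len v = ninv v.
Proof.
rewrite /len; case: ex_minnP => p /existsP[r /eqP rE] min.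
have [r' r'E r's] := exists_word_inv v.
apply/anti_leq/andP; split; last by rewrite -rE -{2}(size_tuple r) inv_word_le.
by rewrite -r's; apply: min; apply/existsP; exists (in_tuple r'); rewrite /= r'E.
Qed.

Lemma redwordE v : word_perm (redword v) = v.
Proof. exact/eqP/(xchooseP (exists_reduced v)). Qed.

Lemma size_redword v : size (redword v) = ninv v.
Proof. by rewrite size_tuple lenE. Qed.

Definition reduced r := size r == ninv (word_perm r).

Lemma redword_reduced v : reduced (redword v).
Proof. by rewrite /reduced redwordE size_redword. Qed.

Lemma reduced_rcons r a : reduced (rcons r a) = reduced r && ~~ desc (word_perm r) a.
Proof.
rewrite /reduced size_rcons word_perm_rcons.
case: (boolP (desc (word_perm r) a)) => d; last by rewrite inv_asc // andbT.
by have := inv_desc d; have := inv_word_le r; lia.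
Qed.

Lemma conj_simple a (i j : 'I_n) v :
  (simple a * (tperm i j * v) = tperm (simple a i) (simple a j) * (simple a * v))%g.
Proof.
by rewrite -tpermJ /conjg -!mulgA simple_mulK /simple tpermV.
Qed.

(** The pair (i, j) is transported through the letters, starting from the last one. To become
    inverted it must at some point coincide with the two positions of a letter, and deleting that
    letter composes the permutation with the transposition. *)
Lemma strong_exchange (i j : 'I_n) r : (i < j)%N -> (word_perm r j < word_perm r i)%N ->
  exists r1 a r2, r = r1 ++ a :: r2 /\ word_perm (r1 ++ r2) = (tperm i j * word_perm r)%g.
Proof.
elim/last_ind: r i j => [|r a IH] i j ij /=; first by rewrite !perm1; lia.
rewrite word_perm_rcons !permM => h.
case: (boolP ((i == adj_lo a) && (j == adj_hi a))) => [/andP[/eqP-> /eqP->]|ne].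
  by exists r, a, [::]; rewrite cats1 cats0 simple_mulK.
have [r1 [b [r2 [rE wE]]]] := IH _ _ (simple_lt ij ne) h.
exists r1, b, (rcons r2 a); split; first by rewrite -cats1 rE -catA /= cats1.
by rewrite -rcons_cat word_perm_rcons wE conj_simple !simpleK.
Qed.

Lemma inv_tperm_lt (i j : 'I_n) v : (i < j)%N -> (v j < v i)%N ->
  (ninv (tperm i j * v)%g < ninv v)%N.
Proof.
move=> ij vij; have := @strong_exchange i j (redword v) ij; rewrite redwordE.
case=> // r1 [a [r2 [rE <-]]].
apply: leq_ltn_trans (inv_word_le _) _.
by rewrite -size_redword rE !size_cat /=; lia.
Qed.

Lemma inv_tperm_gt (i j : 'I_n) v : (i < j)%N -> (v i < v j)%N ->
  (ninv v < ninv (tperm i j * v)%g)%N.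
Proof.
move=> ij vij; have := @inv_tperm_lt i j (tperm i j * v)%g ij.
by rewrite mulgA tperm2 mul1g !permM tpermL tpermR; apply.
Qed.

Lemma perm_neq_lt v (i j : 'I_n) : i != j -> (v i < v j)%N \/ (v j < v i)%N.
Proof.
move=> ij; have : (v i != v j :> nat) by rewrite val_eqE (inj_eq perm_inj).
by lia.
Qed.

(** Truncated subtraction lets the length condition of [step_rel] hold when w is shorter than v. The
    Bruhat condition excludes this, and also equal lengths, since a subsequence of full size is the
    whole word. Conversely, if the length rises by one, strong exchange deletes one letter from a
    reduced word of w and leaves a reduced word of v. *)
Lemma step_rel_tperm (i j : 'I_n) v : i != j ->
  step_rel (tperm i j * v)%g v = (ninv (tperm i j * v)%g == (ninv v).+1).
Proof.
wlog ij : i j / (i < j)%N.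
  move=> H ne; have [/H->//|ji|/val_inj e] := ltngtP i j; last by rewrite e eqxx in ne.
  by rewrite tpermC H // eq_sym.
move=> ne; rewrite /step_rel !lenE; apply/andP/eqP => [[bw le1]|lenw].
  suff : (ninv v < ninv (tperm i j * v)%g)%N by lia.
  case/existsP: bw => r /existsP[r' /and3P[/eqP rE /eqP r'E sub]].
  have := size_subseq sub; rewrite !size_tuple !lenE leq_eqVlt => /orP[/eqP es|//].
  have e : tval r' = tval r.
    by apply/eqP; rewrite -(size_subseq_leqif sub).2 !size_tuple !lenE es.
  have : (tperm i j * v)%g i = v i by rewrite -rE -e r'E.
  by rewrite permM tpermL => /perm_inj e'; rewrite e' eqxx in ne.
split; last by lia.
set w := (_ * v)%g in lenw *.
have [h|vij] : (v i < v j)%N \/ (v j < v i)%N by apply: perm_neq_lt.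
  have := @strong_exchange i j (redword w) ij; rewrite redwordE /w !permM tpermL tpermR.
  case/(_ h) => r1 [a [r2 [rE]]]; rewrite mulgA tperm2 mul1g => rv.
  have s1 : size (redword w) == len w by rewrite lenE size_redword.
  have s2 : size (r1 ++ r2) == len v.
    by rewrite lenE -eqSS -lenw -size_redword -/w rE !size_cat addnS.
  apply/existsP; exists (Tuple s1); apply/existsP; exists (Tuple s2).
  rewrite /= redwordE rv !eqxx /= rE; apply: cat_subseq => //; exact: subseq_cons.
by have := inv_tperm_lt ij vij; rewrite -/w; lia.
Qed.

End Coxeter.

(** * Braid moves *)

Section Braid.
Variable n : nat.
Implicit Types (v w : 'S_n) (a b : 'I_n.-1) (r : seq 'I_n.-1).

Definition far (a b : nat) := (a.+1 < b)%N || (b.+1 < a)%N.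
Definition adjacent (a b : nat) := (a.+1 == b) || (b.+1 == a).

Lemma farC (a b : nat) : far a b = far b a.
Proof. by rewrite /far orbC. Qed.
Lemma adjacentC (a b : nat) : adjacent a b = adjacent b a.
Proof. by rewrite /adjacent orbC. Qed.

Lemma far_lo a b : far a b -> simple a (adj_lo b) = adj_lo b.
Proof. by move=> ab; rewrite tpermD // -val_eqE /=; move: ab; rewrite /far; lia. Qed.

Lemma far_hi a b : far a b -> simple a (adj_hi b) = adj_hi b.
Proof. by move=> ab; rewrite tpermD // -val_eqE /=; move: ab; rewrite /far; lia. Qed.

Lemma desc_far v a b : far a b -> desc (simple a * v)%g b = desc v b.
Proof. by move=> ab; rewrite /desc !permM far_lo // far_hi. Qed.

Lemma next_lo a b : a.+1 = b -> adj_lo b = adj_hi a.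
Proof. by move=> ab; apply: val_inj; rewrite /= ab. Qed.

Lemma next_hi a b : a.+1 = b -> simple a (adj_hi b) = adj_hi b.
Proof. by move=> ab; rewrite tpermD // -val_eqE /=; lia. Qed.

Lemma prev_lo a b : a.+1 = b -> simple b (adj_lo a) = adj_lo a.
Proof. by move=> ab; rewrite tpermD // -val_eqE /=; lia. Qed.

Lemma desc_braid v a b : adjacent a b ->
  desc (simple b * (simple a * v))%g a = desc v b.
Proof.
case/orP=> /eqP ab; rewrite /desc !permM; have lo := next_lo ab.
  have e : simple b (adj_hi a) = adj_hi b by rewrite -lo simple_lo.
  by rewrite lo e prev_lo // next_hi // simple_lo.
have e : simple a (adj_hi b) = adj_hi a by rewrite -lo simple_lo.
by rewrite lo next_hi // !simple_hi prev_lo // lo.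
Qed.

Lemma desc_adjacent v a b : adjacent a b -> desc v a -> desc v b -> desc (simple a * v)%g b.
Proof.
case/orP=> /eqP ab; rewrite /desc !permM => da db; have lo := next_lo ab.
  by move: db; rewrite lo next_hi // simple_hi => db; apply: ltn_trans da.
have e : simple a (adj_hi b) = adj_hi a by rewrite -lo simple_lo.
by move: da; rewrite lo e prev_lo // => da; apply: ltn_trans db.
Qed.

Lemma simple_comm a b : far a b -> (simple a * simple b = simple b * simple a)%g.
Proof.
move=> ab; have := conj_simple a (adj_lo b) (adj_hi b) 1%g.
by rewrite far_lo // far_hi // !mulg1.
Qed.

Lemma simple_braid a b : adjacent a b ->
  (simple a * simple b * simple a = simple b * simple a * simple b)%g.
Proof.
wlog ab : a b / a.+1 = b.
  move=> H h; case/orP: (h) => /eqP ab; first exact: H.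
  by rewrite (H b a) // adjacentC.
move=> _; have := conj_simple a (adj_lo b) (adj_hi b) (simple a).
have := conj_simple b (adj_lo a) (adj_hi a) (simple b).
rewrite !tperm2 !mulg1 -/(simple a) -/(simple b) => e1 e2.
rewrite -!mulgA e1 e2 (prev_lo ab) (next_hi ab) -(next_lo ab) simple_lo.
by rewrite (next_lo ab) simple_hi.
Qed.

Lemma reduced_desc v a r : desc v a -> reduced r -> word_perm r = (simple a * v)%g ->
  reduced (rcons r a) /\ word_perm (rcons r a) = v.
Proof.
by move=> d red rE; rewrite reduced_rcons red word_perm_rcons rE desc_simple d simple_mulK.
Qed.

Section Matsumoto.
Variables (T : Type) (phi : seq 'I_n.-1 -> T).
Hypothesis phi_far : forall r a b r', far a b ->
  phi (r ++ [:: a, b & r']) = phi (r ++ [:: b, a & r']).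
Hypothesis phi_adj : forall r a b r', adjacent a b ->
  phi (r ++ [:: a, b, a & r']) = phi (r ++ [:: b, a, b & r']).

(** If the last letters a and b differ, both are descents of v, so v also has reduced words ending
    in either alternating word of length 2 or 3 in a and b. These differ by one move, and the
    induction hypothesis links each of them to a given word. The suffix t records the letters
    already split off, [phi] being an arbitrary function of whole words. *)
Lemma matsumoto_suffix r r' t : reduced r -> reduced r' -> word_perm r = word_perm r' ->
  phi (r ++ t) = phi (r' ++ t).
Proof.
move: {2}(size r) (erefl (size r)) => k; elim: k r r' t => [|k IH] r r' t rk red red' rr'.
  have : size r' = 0%N by rewrite (eqP red') -rr' -(eqP red).
  by move/eqP/nilP=> ->; move/eqP/nilP: rk => ->.
have : size r' = k.+1 by rewrite (eqP red') -rr' -(eqP red).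
case/lastP: r rk red rr' => // q a; case/lastP: r' red' => // q' b.
rewrite !size_rcons => red' [qk] red rr' [q'k].
have := red; have := red'; rewrite !reduced_rcons => /andP[redq' ab] /andP[redq aa].
set v := word_perm (rcons q a) in rr'.
have qv : word_perm q = (simple a * v)%g by rewrite /v word_perm_rcons simple_mulK.
have q'v : word_perm q' = (simple b * v)%g by rewrite rr' word_perm_rcons simple_mulK.
have da : desc v a by rewrite -[desc v a]negbK -desc_simple -qv.
have db : desc v b by rewrite -[desc v b]negbK -desc_simple -q'v.
rewrite -!cats1 -!catA /=.
have [eab|neab] := eqVneq a b; first by rewrite -eab; apply: IH; rewrite // qv q'v eab.
have [fab|nfab] := boolP (far a b).
  have da' : desc (simple b * v)%g a by rewrite desc_far // farC.
  have db' : desc (simple a * v)%g b by rewrite desc_far.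
  have := redword_reduced (simple b * (simple a * v))%g.
  move: (redword _) (redwordE (simple b * (simple a * v))%g) => p pE redp.
  have [red1 w1] := reduced_desc db' redp pE.
  have [red2 w2] : reduced (rcons p a) /\ word_perm (rcons p a) = (simple b * v)%g.
    by apply: reduced_desc; rewrite // pE !mulgA simple_comm // farC.
  rewrite (IH q (rcons p b)) ?w1 // (IH q' (rcons p a)) ?w2 //.
  by rewrite -!cats1 -!catA /= phi_far // farC.
have aab : adjacent a b by move: nfab neab; rewrite /far /adjacent -val_eqE /=; lia.
have bab : adjacent b a by rewrite adjacentC.
have d1 := desc_adjacent aab da db; have d3 := desc_adjacent bab db da.
have d2 : desc (simple b * (simple a * v))%g a by rewrite desc_braid.
have d4 : desc (simple a * (simple b * v))%g b by rewrite desc_braid.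
(* Stripping s_a s_b s_a from the end of v leaves u; with p a reduced word of u, the two words to
   compare become p a b a and p b a b. *)
pose u := (simple a * (simple b * (simple a * v)))%g.
have uE : u = (simple b * (simple a * (simple b * v)))%g.
  by rewrite /u !mulgA (simple_braid aab).
have := redword_reduced u.
move: (redword _) (redwordE u) => p pE redp.
have [red1 w1] := reduced_desc d2 redp pE.
have [red2 w2] := reduced_desc d1 red1 w1.
have [red3 w3] := reduced_desc d4 redp (etrans pE uE).
have [red4 w4] := reduced_desc d3 red3 w3.
rewrite (IH q (rcons (rcons p a) b)) ?w2 // (IH q' (rcons (rcons p b) a)) ?w4 //.
by rewrite -!cats1 -!catA /= phi_adj.
Qed.

Lemma matsumoto r r' : reduced r -> reduced r' -> word_perm r = word_perm r' -> phi r = phi r'.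
Proof. by move=> red red' e; rewrite -[r]cats0 -[r']cats0; apply: matsumoto_suffix. Qed.

End Matsumoto.
End Braid.

(** * Signed sums over Bruhat covers and their interaction with descents *)

Section Monk.
Variables (n : nat) (A : zmodType).
Implicit Types (v w : 'S_n) (a b : 'I_n.-1) (f : 'S_n -> A) (i j : 'I_n).

Definition descop a f v : A := if desc v a then f (simple a * v)%g else 0.

Definition isign (i j : 'I_n) : int := if (i < j)%N then 1 else -1.

Definition covers i j v := (i != j) && (ninv (tperm i j * v)%g == (ninv v).+1).

(** This is the right-hand side of Monk's rule for x_i, with an arbitrary function f in place of the
    Schubert polynomials, so that its behaviour under descents is pure combinatorics. *)
Definition monkop i f v : A :=
  \sum_(j | covers i j v) f (tperm i j * v)%g *~ isign i j.

Lemma isignC i j : i != j -> isign j i = - isign i j.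
Proof. by rewrite /isign -val_eqE /=; case: ltngtP. Qed.

Lemma simple_lt_iff a i j : i != j -> ~~ ((i == adj_lo a) && (j == adj_hi a)) ->
  ~~ ((j == adj_lo a) && (i == adj_hi a)) -> (simple a i < simple a j)%N = (i < j)%N.
Proof.
move=> ne nij nji; apply/idP/idP => [|ij]; last exact: simple_lt.
by apply: contraTT; rewrite -!leqNgt => ji; apply/ltnW/simple_lt => //; move: ne; rewrite -val_eqE /=; lia.
Qed.

Lemma inv_simple v a : ninv (simple a * v)%g = if desc v a then (ninv v).-1 else (ninv v).+1.
Proof.
case: (boolP (desc v a)) => d; last exact: inv_asc.
by rewrite (inv_desc d).
Qed.

(** Both conditions say that v t_ij has a descent at a and v t_ij s_a has the length of v. If v had
    an ascent at a, then v s_a would be longer than v, whereas the transposition from v s_a to v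
    t_ij s_a still raises the length, s_a preserving the order of i and j. *)
Lemma covers_desc a i j v : i != j -> ~~ ((i == adj_lo a) && (j == adj_hi a)) ->
    ~~ ((j == adj_lo a) && (i == adj_hi a)) ->
  covers i j v && desc (tperm i j * v)%g a =
  desc v a && covers (simple a i) (simple a j) (simple a * v)%g.
Proof.
move=> ne nij nji; rewrite /covers ne (inj_eq (@simple_inj _ a)) ne /= -conj_simple.
wlog lij : i j ne nij nji / (i < j)%N.
  move=> H; have [/H->//|ji|/val_inj e] := ltngtP i j; last by rewrite e eqxx in ne.
  by rewrite tpermC; apply: H => //; rewrite eq_sym.
have lsij : (simple a i < simple a j)%N by rewrite simple_lt.
apply/andP/andP => [[/eqP cov dw]|[dv /eqP cov]].
  have inve : ninv (simple a * (tperm i j * v))%g = ninv v by rewrite inv_simple dw cov.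
  case: (boolP (desc v a)) => dv; first by rewrite inve {1}(inv_desc dv).
  exfalso.
  have [lv|lv] := perm_neq_lt v ne; last by have := inv_tperm_lt lij lv; lia.
  have := @inv_tperm_gt _ _ _ (simple a * v)%g lsij.
  rewrite !permM !simpleK => /(_ lv); rewrite -conj_simple inve inv_simple (negbTE dv); lia.
have {}cov : ninv (simple a * (tperm i j * v))%g = ninv v by rewrite cov -(inv_desc dv).
have [lv|lv] := perm_neq_lt v ne; last first.
  have := @inv_tperm_lt _ _ _ (simple a * v)%g lsij.
  rewrite !permM !simpleK => /(_ lv); rewrite -conj_simple cov; have := inv_desc dv; lia.
have := inv_tperm_gt lij lv; move: cov; rewrite inv_simple.
by case: ifP => _; lia.
Qed.

(** A Leibniz rule, the last integer being the divided difference of x_i. The covers on both sides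
    correspond under conjugation by s_a unless the transposition is s_a itself. That one contributes
    to the left side if v has an ascent at a, and to the right side with the opposite sign if it has
    a descent; in both cases the difference is the extra term. *)
Lemma monkop_descop a i f v :
  monkop i (descop a f) v = descop a (monkop (simple a i) f) v
    + f v *~ ((i == adj_lo a)%:Z - (i == adj_hi a)%:Z).
Proof.
have RE : descop a (monkop (simple a i) f) v =
    \sum_(j | covers (simple a i) (simple a j) (simple a * v)%g && desc v a)
      f (simple a * (tperm i j * v))%g *~ isign (simple a i) (simple a j).
  rewrite /descop /monkop; case: (boolP (desc v a)) => d; last first.
    by rewrite big_pred0 // => j; rewrite andbF.
  rewrite (reindex_inj (@simple_inj _ a)) /=.
  by apply: eq_big => [j|j _]; rewrite ?andbT // conj_simple.
have LE : monkop i (descop a f) v =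
    \sum_(j | covers i j v && desc (tperm i j * v)%g a)
      f (simple a * (tperm i j * v))%g *~ isign i j.
  rewrite /monkop /descop [in RHS]big_mkcondr /=; apply: eq_bigr => j _.
  by case: ifP => // _; rewrite mul0rz.
rewrite {}LE {}RE.
have gen j : ~~ ((i == adj_lo a) && (j == adj_hi a)) -> ~~ ((j == adj_lo a) && (i == adj_hi a)) ->
  (covers i j v && desc (tperm i j * v)%g a =
    covers (simple a i) (simple a j) (simple a * v)%g && desc v a)
  /\ (covers i j v -> isign (simple a i) (simple a j) = isign i j).
  move=> h1 h2; have [<-|ne] := eqVneq i j; first by rewrite /covers !eqxx.
  by rewrite covers_desc // andbC; split=> // _; rewrite /isign simple_lt_iff.
have special j : i != j -> simple a i = j -> simple a = tperm i j ->
  (\sum_(j | covers i j v && desc (tperm i j * v)%g a)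
      f (simple a * (tperm i j * v))%g *~ isign i j =
   \sum_(j | covers (simple a i) (simple a j) (simple a * v)%g && desc v a)
      f (simple a * (tperm i j * v))%g *~ isign (simple a i) (simple a j) + f v *~ isign i j).
  move=> ne ij sE.
  have ji : simple a j = i by rewrite -ij simpleK.
  rewrite big_mkcond [in RHS]big_mkcond /= (bigD1 j) //= [in RHS](bigD1 j) //= addrAC.
  congr (_ + _).
    rewrite ij ji -sE simple_mulK (isignC ne) mulrNz desc_simple.
    rewrite /covers [j == i]eq_sym ne (tpermC j) -sE simple_mulK inv_simple /=.
    case: (boolP (desc v a)) => d /=; last by rewrite eqxx andbF add0r.
    by rewrite andbF andbT (inv_desc d) /= eqxx addNr.
  apply: eq_bigr => k kj; have [||e h] := gen k.
  - apply/negP => /andP[/eqP e1 /eqP e2]; case/eqP: kj.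
    by rewrite -ij e1 e2 simple_lo.
  - apply/negP => /andP[/eqP e1 /eqP e2]; case/eqP: kj.
    by rewrite -ij e1 e2 simple_hi.
  by rewrite -e; case: ifP => // /andP[/h -> _].
have [ilo|nlo] := eqVneq i (adj_lo a).
  rewrite (special (adj_hi a)) ?ilo ?adj_neq ?simple_lo //.
  by rewrite /isign /= ltnSn.
have [ihi|nhi] := eqVneq i (adj_hi a).
  rewrite (special (adj_lo a)) ?ihi ?[_ == adj_lo a]eq_sym ?adj_neq ?simple_hi 1?tpermC //.
  by rewrite /isign /= ltnNge leqnSn.
rewrite mulr0z addr0; apply: eq_big => j.
  by have [||-> _] := gen j; rewrite ?negb_and ?nlo ?nhi ?orbT.
by case/andP=> c _; have [||_ ->] := gen j; rewrite ?negb_and ?nlo ?nhi ?orbT.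
Qed.

End Monk.

(** * Divided differences *)

(* Leibniz rule and braid relations of divided differences (f - s f) / A, away
   from any division. *)
Section TwistedDifferences.
Variables (R : comNzRingType) (s t : {rmorphism R -> R}).
Implicit Types (A B f g h k : R).

Lemma twisted_diffB A f g f' g' : f' * A = f - s f -> g' * A = g - s g ->
  (f' - g') * A = (f - g) - s (f - g).
Proof. by move=> e1 e2; rewrite mulrBl e1 e2 raddfB /=; ring. Qed.

Lemma twisted_diffM A f g f' g' : f' * A = f - s f -> g' * A = g - s g ->
  (f' * g + s f * g') * A = f * g - s (f * g).
Proof.
move=> e1 e2; have -> : (f' * g + s f * g') * A = (f' * A) * g + s f * (g' * A) by ring.
by rewrite e1 e2 rmorphM /=; ring.
Qed.

Lemma twisted_diff2 A B f g h : s B = B -> g * B = f - t f -> h * A = g - s g ->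
  h * (A * B) = f - t f - s f + s (t f).
Proof.
move=> sB gE hE; have gE' : s g * B = s f - s (t f) by rewrite -{1}sB -rmorphM gE raddfB.
have -> : h * (A * B) = g * B - s g * B by rewrite mulrA hE; ring.
by rewrite gE gE'; ring.
Qed.

(** The common denominator is the product of the three positive roots, and the numerator is an
    alternating sum over the group generated by s and t. The sum becomes symmetric in s and t once
    sts = tst, which yields the braid relation. *)
Lemma twisted_diff3 A B f g h k : s A = - A -> s B = A + B -> t A = A + B ->
  g * A = f - s f -> s g = g -> h * B = g - t g -> k * A = h - s h ->
  k * (A * B * (A + B)) =
    f - s f - t f + s (t f) + t (s f) - s (t (s f)).
Proof.
move=> sA sB tA gE sg hE kE.
have e1 : s h * (A + B) = g - s (t g) by rewrite -sB -rmorphM hE raddfB /= sg.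
have e2 : t g * (A + B) = t f - t (s f) by rewrite -tA -rmorphM gE raddfB.
have e3 : s (t g) * B = s (t f) - s (t (s f)).
  have -> : s (t f) - s (t (s f)) = s (t g * (A + B)) by rewrite e2 raddfB.
  by rewrite rmorphM raddfD /= sA sB addKr.
have -> : k * (A * B * (A + B)) = (k * A) * B * (A + B) by ring.
have -> : (k * A) * B * (A + B) = (h * B) * (A + B) - s h * (A + B) * B by rewrite kE; ring.
rewrite hE e1.
have -> : (g - t g) * (A + B) - (g - s (t g)) * B = g * A - t g * (A + B) + s (t g) * B by ring.
by rewrite gE e2 e3; ring.
Qed.

Lemma Leibniz_split (f g h k l : R) :
  f - g * h = (f - (g * h + k * l)) + k * l.
Proof. by ring. Qed.

End TwistedDifferences.

Lemma swap_sum2 (V : zmodType) (f x y u : V) : f - x - y + u = f - y - x + u.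
Proof. by rewrite (addrAC f). Qed.

Lemma swap_sum3 (V : zmodType) (f x y u w z : V) :
  f - x - y + u + w - z = f - y - x + w + u - z.
Proof. by rewrite (addrAC f) (addrAC _ u w). Qed.

Lemma mul_cancel2 (R : idomainType) (A B x y S T : R) : A != 0 -> B != 0 ->
  x * (A * B) = S -> y * (B * A) = T -> S = T -> x = y.
Proof.
move=> A0 B0 e1 e2 e; apply: (mulIf (mulf_neq0 A0 B0)).
by rewrite e1 [A * B]mulrC e2.
Qed.

Lemma mul_cancel3 (R : idomainType) (A B x y S T : R) : A != 0 -> B != 0 -> A + B != 0 ->
  x * (A * B * (A + B)) = S -> y * (B * A * (B + A)) = T -> S = T -> x = y.
Proof.
rewrite [B + A]addrC [B * A]mulrC => A0 B0 AB0 e1 e2 e.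
by apply: (mulIf (mulf_neq0 (mulf_neq0 A0 B0) AB0)); rewrite e1 e2.
Qed.

Section DividedDifferences.
Variable n : nat.
Implicit Types (v w : 'S_n) (a b : 'I_n.-1) (f g h : {mpoly int[n]}).

Definition simple_root a : {mpoly int[n]} := 'X_(adj_lo a) - 'X_(adj_hi a).

Lemma msymXi (s : 'S_n) i : msym s 'X_i = 'X_(s i) :> {mpoly int[n]}.
Proof. by rewrite /msym mmapX mmap1U. Qed.

Lemma msymK a f : msym (simple a) (msym (simple a) f) = f.
Proof. by rewrite -msymMm tperm2 msym1m. Qed.

Lemma mpolyX_neq i j : i != j -> 'X_i != 'X_j :> {mpoly int[n]}.
Proof.
move=> ij; apply/eqP => /(congr1 (mcoeff U_(i))); rewrite !mcoeffXU eqxx eq_sym (negbTE ij).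
exact/eqP.
Qed.

Lemma root_neq0 a : simple_root a != 0.
Proof. by rewrite subr_eq0 mpolyX_neq // adj_neq. Qed.

Lemma root_msym a : msym (simple a) (simple_root a) = - simple_root a.
Proof. by rewrite raddfB /= !msymXi simple_lo simple_hi opprB. Qed.

Lemma ddiffE a f : ddiff a f * simple_root a = f - msym (simple a) f.
Proof. exact: ddiffP. Qed.

Lemma ddiff_uniq a f g : g * simple_root a = f - msym (simple a) f -> ddiff a f = g.
Proof. by rewrite -ddiffE => /(mulIf (root_neq0 a)). Qed.

Lemma ddiffB a : {morph ddiff a : f g / f - g}.
Proof. by move=> f g; apply/ddiff_uniq/twisted_diffB; rewrite ddiffE. Qed.
HB.instance Definition _ a := GRing.isZmodMorphism.Build _ _ (ddiff a) (@ddiffB a).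

Lemma ddiffD a f g : ddiff a (f + g) = ddiff a f + ddiff a g.
Proof. exact: (raddfD (ddiff a)). Qed.

Lemma ddiffM a f g : ddiff a (f * g) = ddiff a f * g + msym (simple a) f * ddiff a g.
Proof.
by apply/ddiff_uniq/twisted_diffM; rewrite ddiffE.
Qed.

Lemma msym_ddiff a f : msym (simple a) (ddiff a f) = ddiff a f.
Proof.
apply: (mulIf (root_neq0 a)); apply: oppr_inj; rewrite -mulrN -root_msym -rmorphM ddiffE.
by rewrite raddfB /= msymK opprB.
Qed.

Lemma ddiff_sym a f : msym (simple a) f = f -> ddiff a f = 0.
Proof. by move=> sf; apply: ddiff_uniq; rewrite sf subrr mul0r. Qed.

Lemma ddiff_ddiff a f : ddiff a (ddiff a f) = 0.
Proof. exact/ddiff_sym/msym_ddiff. Qed.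

Lemma ddiff_symM a f g : f \is symmetric -> ddiff a (f * g) = f * ddiff a g.
Proof. by move=> /issymP sf; rewrite ddiffM ddiff_sym // mul0r add0r sf. Qed.

Lemma msymX_far a b : far a b -> msym (simple a) (simple_root b) = simple_root b.
Proof. by move=> ab; rewrite raddfB /= !msymXi far_lo // far_hi. Qed.

Lemma msymX_adj a b : adjacent a b -> msym (simple a) (simple_root b) = simple_root a + simple_root b.
Proof.
rewrite raddfB /= !msymXi /simple_root; case/orP => /eqP ab.
  by rewrite next_hi // (next_lo ab) simple_hi [RHS]addrA subrK.
by rewrite -(next_lo ab) prev_lo // simple_lo [RHS]addrC addrA subrK.
Qed.

Local Opaque simple_root ddiff.

Lemma ddiff_comm a b f : far a b -> ddiff a (ddiff b f) = ddiff b (ddiff a f).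
Proof.
move=> ab; have ba : far b a by rewrite farC.
have E (c d : 'I_n.-1) : far c d -> ddiff c (ddiff d f) * (simple_root c * simple_root d) =
    f - msym (simple d) f - msym (simple c) f + msym (simple c) (msym (simple d) f).
  by move=> cd; apply: twisted_diff2 (msymX_far cd) (ddiffE d f) (ddiffE c _).
apply: (mul_cancel2 (root_neq0 a) (root_neq0 b) (E a b ab) (E b a ba)).
by rewrite -!msymMm (simple_comm ab); exact: swap_sum2.
Qed.

Lemma ddiff_braid a b f : adjacent a b ->
  ddiff a (ddiff b (ddiff a f)) = ddiff b (ddiff a (ddiff b f)).
Proof.
move=> ab; have ba : adjacent b a by rewrite adjacentC.
have E (c d : 'I_n.-1) : adjacent c d -> ddiff c (ddiff d (ddiff c f)) * (simple_root c * simple_root d * (simple_root c + simple_root d)) =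
   f - msym (simple c) f - msym (simple d) f + msym (simple c) (msym (simple d) f)
   + msym (simple d) (msym (simple c) f) - msym (simple c) (msym (simple d) (msym (simple c) f)).
  move=> cd; have dc : adjacent d c by rewrite adjacentC.
  apply: (twisted_diff3 (s := msym (simple c)) (t := msym (simple d)) (root_msym c)
    (msymX_adj cd) (etrans (msymX_adj dc) (addrC _ _))
    (ddiffE c f) (msym_ddiff c f) (ddiffE d _) (ddiffE c _)).
have nz : simple_root a + simple_root b != 0.
  by rewrite -(msymX_adj ab) raddf_eq0 ?root_neq0 //; apply: inj_msym.
apply: (mul_cancel3 (root_neq0 a) (root_neq0 b) nz (E a b ab) (E b a ba)).
by rewrite -!msymMm (simple_braid ab); exact: swap_sum3.
Qed.

Lemma msize_msym_le (s : 'S_n) f : (msize (msym s f) <= msize f)%N.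
Proof.
rewrite [msize (msym _ _)]msizeE; apply/bigmax_leqP_seq => m; rewrite mcoeff_msupp mcoeff_sym => mf _.
have := @msize_mdeg_lt _ _ f _ (etrans (mcoeff_msupp _ _) mf).
by rewrite mdeg_mperm.
Qed.

Lemma msize_ddiff a f : ddiff a f != 0 -> (msize (ddiff a f) < msize f)%N.
Proof.
move=> nz; have : (msize (ddiff a f * simple_root a) <= msize f)%N.
  rewrite ddiffE; apply: leq_trans (msizeD_le _ _) _.
  by rewrite geq_max leqnn msizeN msize_msym_le.
rewrite msizeM ?root_neq0 //.
suff : (2 <= msize (simple_root a))%N by move: (msize (ddiff a f)) (msize (simple_root a)) (msize f); lia.
rewrite ltnNge; apply/negP => /msize1_polyC e.
have := congr1 (mcoeff U_(adj_lo a)) e.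
rewrite mcoeffB !mcoeffXU eqxx eq_sym adj_neq mcoeffC mnm1_eq0 /= mulr0.
exact/eqP.
Qed.

Definition ddiffs (r : seq 'I_n.-1) f := foldr (@ddiff n) f r.

Lemma ddiffs_cat r r' f : ddiffs (r ++ r') f = ddiffs r (ddiffs r' f).
Proof. exact: foldr_cat. Qed.

Lemma ddiffs_cons a r f : ddiffs (a :: r) f = ddiff a (ddiffs r f).
Proof. by []. Qed.

Lemma ddiffs_far r a b r' : far a b ->
  ddiffs (r ++ [:: a, b & r']) = ddiffs (r ++ [:: b, a & r']) :> (_ -> _).
Proof.
move=> ab; apply: boolp.funext => f; rewrite !ddiffs_cat; apply: congr1.
by rewrite !ddiffs_cons; apply: ddiff_comm.
Qed.

Lemma ddiffs_adj r a b r' : adjacent a b ->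
  ddiffs (r ++ [:: a, b, a & r']) = ddiffs (r ++ [:: b, a, b & r']) :> (_ -> _).
Proof.
move=> ab; apply: boolp.funext => f; rewrite !ddiffs_cat; apply: congr1.
by rewrite !ddiffs_cons; apply: ddiff_braid.
Qed.

Lemma ddiffs_reduced r r' f : reduced r -> reduced r' -> word_perm r = word_perm r' ->
  ddiffs r f = ddiffs r' f.
Proof. by move=> h h' e; rewrite (matsumoto ddiffs_far ddiffs_adj h h' e). Qed.

Lemma ddiff0_symmetric f : (forall a, ddiff a f = 0) -> f \is symmetric.
Proof.
move=> h; have hs a : msym (simple a) f = f.
  by apply/esym/eqP; rewrite -subr_eq0 -ddiffE h mul0r.
apply/issymP => s; have [r <-] := exists_word s.
by elim/last_ind: r => [|r a IH]; rewrite ?msym1m // word_perm_rcons msymMm hs.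
Qed.

Definition const_term f : int := f@_0%MM.

Local Notation I := (@sym_ideal n).

Lemma sym_ideal0 : I 0.
Proof. exact: in_ideal0. Qed.

Lemma sym_idealB f g : I f -> I g -> I (f - g).
Proof. exact: in_idealB. Qed.

Lemma sym_idealN f : I f -> I (- f).
Proof. by move=> If; rewrite -sub0r; apply: sym_idealB => //; apply: sym_ideal0. Qed.

Lemma sym_idealD f g : I f -> I g -> I (f + g).
Proof. by move=> If Ig; rewrite -[g]opprK; apply/sym_idealB/sym_idealN. Qed.

Lemma sym_idealMl f g : I g -> I (f * g).
Proof. by move=> Ig; rewrite -[f * g]mulr1; apply: in_idealM. Qed.

Lemma sym_ideal_gen f : f \is symmetric -> const_term f = 0 -> I f.
Proof.
move=> sf cf; exists [:: (1, f, 1)]; first by move=> t; rewrite inE => /eqP ->.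
by rewrite big_seq1 mul1r mulr1.
Qed.

Lemma sym_ideal_elim (P : {mpoly int[n]} -> Prop) : P 0 -> (forall f g, P f -> P g -> P (f + g)) ->
  (forall f g, f \is symmetric -> const_term f = 0 -> P (f * g)) -> forall f, I f -> P f.
Proof.
move=> P0 PD PM f [ts ht ->]; rewrite big_seq; apply: (big_ind P) => // t /ht [st ct].
by rewrite [t.1.1 * _]mulrC -mulrA; apply: PM.
Qed.

Lemma sym_ideal_const f : I f -> const_term f = 0.
Proof.
apply: (@sym_ideal_elim (fun f => const_term f = 0)).
- exact: mcoeff0.
- by move=> {}f g hf hg; rewrite /const_term mcoeffD -/(const_term f) -/(const_term g) hf hg.
- by move=> {}f g _ cf; rewrite /const_term rmorphM /= -/(const_term f) cf mul0r.
Qed.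

Lemma sym_ideal_ddiff a f : I f -> I (ddiff a f).
Proof.
apply: (@sym_ideal_elim (fun f => I (ddiff a f))).
- by rewrite raddf0; apply: sym_ideal0.
- by move=> {}f g hf hg; rewrite ddiffD; apply: sym_idealD.
- move=> {}f g sf cf; rewrite ddiff_symM // mulrC; apply/sym_idealMl/sym_ideal_gen => //.
Qed.

Lemma sym_ideal_ddiffs r f : I f -> I (ddiffs r f).
Proof. by move=> If; elim: r => [|a r IH] //=; apply: sym_ideal_ddiff. Qed.

Lemma ddiffsB r : {morph ddiffs r : f g / f - g}.
Proof. by move=> f g; elim: r => [|a r IH] //=; rewrite IH raddfB. Qed.
HB.instance Definition _ r := GRing.isZmodMorphism.Build _ _ (ddiffs r) (@ddiffsB r).

(* Modulo the ideal, f is invariant under all simple transpositions, so the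
   Leibniz rule lets f through divided differences. *)
Lemma ddiffs_mulr_mod r f g : (forall a, I (ddiff a f)) -> I (ddiffs r (g * f) - ddiffs r g * f).
Proof.
move=> hf; elim: r => [|a r IH] /=; first by rewrite subrr; apply: sym_ideal0.
have := sym_ideal_ddiff a IH; rewrite ddiffB ddiffM => h.
rewrite (Leibniz_split _ _ _ (msym (simple a) (ddiffs r g)) (ddiff a f)).
by apply: sym_idealD => //; apply/sym_idealMl.
Qed.

End DividedDifferences.

(** * The Yang-Baxter equation *)

Section YangBaxter.
Variables (P : comNzRingType) (V : lmodType P) (e : nat -> {linear V -> V}).
Implicit Types (x y : P) (v : V).
Hypothesis e_sq : forall k v, e k (e k v) = 0.
Hypothesis e_far : forall i j v, far i j -> e i (e j v) = e j (e i v).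
Hypothesis e_braid : forall k v, e k (e k.+1 (e k v)) = e k.+1 (e k (e k.+1 v)).

Let eD k u v : e k (u + v) = e k u + e k v.
Proof. exact: linearD. Qed.

Let eZ k x v : e k (x *: v) = x *: e k v.
Proof. exact: linearZ. Qed.

Definition factor k x v := v + x *: e k v.

(* The operators act on the right: hrow s d x is multiplication by
   (1 + x e_(s+d-1)) ... (1 + x e_s). *)
Fixpoint hrow s d x v := if d is d'.+1 then factor s x (hrow s.+1 d' x v) else v.

Lemma factor_far i j x y v : far i j -> factor i x (factor j y v) = factor j y (factor i x v).
Proof.
move=> ij; rewrite /factor !(eD, eZ) e_far // !scalerDr.
rewrite -!addrA; congr (_ + _); rewrite addrCA; congr (_ + _); congr (_ + _).
by rewrite !scalerA mulrC.
Qed.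

Lemma factorD k x y v : factor k x (factor k y v) = factor k (x + y) v.
Proof. by rewrite /factor eD eZ e_sq scaler0 addr0 scalerDl -addrA [x *: _ + _]addrC. Qed.

Lemma factor0 k v : factor k 0 v = v.
Proof. by rewrite /factor scale0r addr0. Qed.

Lemma factor_row s d i x y v : (i.+1 < s)%N -> factor i y (hrow s d x v) = hrow s d x (factor i y v).
Proof.
elim: d s => [//|d IH] s si /=.
by rewrite factor_far ?IH // /far; lia.
Qed.

Lemma yang_baxter k x y v :
  factor k x (factor k.+1 (x + y) (factor k y v)) =
  factor k.+1 y (factor k (x + y) (factor k.+1 x v)).
Proof.
rewrite /factor !(eD, eZ) !e_sq e_braid.
move: (e k v) (e k.+1 v) => p q; move: (e k q) (e k.+1 p) (e k.+1 _) => r t u.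
rewrite !scaler0 !addr0 !scalerDr !scalerA !scalerDl.
have -> : y * (x + y) * x = x * (x + y) * y by ring.
by rewrite (mulrC _ y) (mulrC _ x) !addrA [LHS](ACl (1 * 3 * 6 * 2 * 7 * 4 * 5 * 8)).
Qed.

(** The Yang-Baxter equation exchanges x and y in the factors of lowest index and leaves a
    correction on e_(s+1), which the induction hypothesis for the shorter rows absorbs. *)
Lemma row_comm s d x y v : hrow s d y (hrow s d x v) = hrow s d x (hrow s d y v).
Proof.
elim: d s v => [//|[|d] IH] s v; first by rewrite /= !factorD addrC.
(* Yang-Baxter is used with parameters y - x and x. The leftover factor 1 + (y - x) e_(s+1) splits
   below into the parameters -x and y: the second completes a row for the induction hypothesis, and
   the first then cancels. *)
have ybe u : factor s y (factor s.+1 y (factor s x u)) =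
    factor s x (factor s.+1 x (factor s y (factor s.+1 (y - x) u))).
  have -> : factor s y (factor s.+1 y (factor s x u)) =
      factor s x (factor s (y - x) (factor s.+1 (y - x + x) (factor s x u))).
    by rewrite subrK [RHS]factorD addrC subrK.
  by rewrite yang_baxter subrK.
have far_row (z t : P) u : factor s z (hrow s.+2 d t u) = hrow s.+2 d t (factor s z u).
  by apply: factor_row.
have := IH s.+1; rewrite /= => comm.
rewrite -far_row ybe.
set u := hrow s.+2 d y _.
have -> : factor s.+1 (y - x) u = factor s.+1 (- x) (factor s.+1 y u).
  by rewrite factorD addrC.
rewrite /u comm.
by rewrite [factor s.+1 (- x) _]factorD addNr factor0 -far_row.
Qed.

Variables (tau : P -> P) (sigma : V -> V).
Hypothesis sigmaD : {morph sigma : u v / u + v}.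
Hypothesis sigmaZ : forall x v, sigma (x *: v) = tau x *: sigma v.
Hypothesis sigma_e : forall k v, sigma (e k v) = e k (sigma v).

Lemma sigma_factor k x v : sigma (factor k x v) = factor k (tau x) (sigma v).
Proof. by rewrite /factor sigmaD sigmaZ sigma_e. Qed.

Lemma sigma_row s d x v : sigma (hrow s d x v) = hrow s d (tau x) (sigma v).
Proof. by elim: d s => [|d IH] s //=; rewrite sigma_factor IH. Qed.

(** Let R be the product of two full rows in x and y, symmetric by [row_comm]. Then z is R times 1 -
    y e_a and its image under [sigma] is R times 1 - x e_a, while R e_a = z e_a because e_a squares
    to zero. *)
Lemma row_ddiff a d x y v : tau x = y -> tau y = x -> sigma v = v ->
  let z := hrow a.+1 d y (hrow a d.+1 x v) in z - sigma z = (x - y) *: e a z.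
Proof.
move=> xy yx sv z; rewrite /z !sigma_row sv xy yx.
have rowE t u : hrow a.+1 d t u = factor a (- t) (hrow a d.+1 t u).
  by rewrite /= factorD addNr factor0.
rewrite (rowE y) (rowE x) -row_comm /factor eD eZ e_sq scaler0 addr0.
by rewrite opprD addrACA subrr add0r !scaleNr opprK addrC scalerBl.
Qed.

Lemma ddiff_factor a k x y t v : (a.+1 < k)%N -> tau t = t ->
  v - sigma v = (x - y) *: e a v ->
  factor k t v - sigma (factor k t v) = (x - y) *: e a (factor k t v).
Proof.
move=> ak tt h; rewrite sigma_factor tt /factor eD eZ (e_far v (i := a)); last first.
  by rewrite /far ak.
by rewrite opprD addrACA h scalerDr -scalerBr -linearB h linearZ /= !scalerA mulrC.
Qed.

Lemma ddiff_row a s d x y t v : (a.+1 < s)%N -> tau t = t ->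
  v - sigma v = (x - y) *: e a v ->
  hrow s d t v - sigma (hrow s d t v) = (x - y) *: e a (hrow s d t v).
Proof.
move=> + tt h; elim: d s => [//|d IH] s sa /=.
by apply: ddiff_factor => //; apply: IH; lia.
Qed.

End YangBaxter.

(** * Factorization of Schubert polynomials *)

Section FominStanley.
Variable n : nat.
Local Notation P := {mpoly int[n]}.
Local Notation V := {ffun 'S_n -> P^o}.
Implicit Types (f g v : V) (x : P) (w u : 'S_n) (a b : 'I_n.-1) (i j k s t d : nat).

(* A vector f stands for the element \sum_w f w *: e_w of the nilCoxeter
   algebra, and nil_op k for the right multiplication by e_k. *)
Definition nil_op k f : V :=
  [ffun w => oapp (fun a : 'I_n.-1 => descop a f w : P) 0 (insub k)].

Fact nil_op_linear k : linear (nil_op k).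
Proof.
move=> x f g; apply/ffunP => w; rewrite !ffunE.
case: (insub k) => [a|] /=; last by rewrite scaler0 addr0.
by rewrite /descop; case: ifP => _; rewrite ?ffunE // scaler0 addr0.
Qed.
HB.instance Definition _ k :=
  GRing.isLinear.Build P V V *:%R (nil_op k) (nil_op_linear k).

Lemma nil_opE a f w : nil_op a f w = descop a f w.
Proof. by rewrite ffunE valK. Qed.

Lemma nil_op_default k f : (n.-1 <= k)%N -> nil_op k f = 0.
Proof. by move=> nk; apply/ffunP => w; rewrite !ffunE insubN // -leqNgt. Qed.

Lemma nil_op_sq k f : nil_op k (nil_op k f) = 0.
Proof.
case: (ltnP k n.-1) => [km|km]; last by rewrite (nil_op_default _ km).
apply/ffunP => w; rewrite (nil_opE (Ordinal km)) /descop (nil_opE (Ordinal km)) /descop desc_simple ffunE.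
by case: desc.
Qed.

Lemma nil_op_far i j f : far i j -> nil_op i (nil_op j f) = nil_op j (nil_op i f).
Proof.
move=> ij; case: (ltnP i n.-1) => [im|im]; last by rewrite !(nil_op_default _ im) linear0.
case: (ltnP j n.-1) => [jm|jm]; last by rewrite !(nil_op_default _ jm) linear0.
pose a := Ordinal im; pose b := Ordinal jm.
apply/ffunP => w; rewrite (nil_opE a) (nil_opE b) /descop (nil_opE a) (nil_opE b) /descop.
rewrite !desc_far //; last by rewrite farC.
by case: (desc w a); case: (desc w b) => //; rewrite !mulgA (@simple_comm _ a b ij).
Qed.

Lemma descop_braid (f : 'S_n -> P) a b w : adjacent a b ->
  descop a (descop b (descop a f)) w =
  if desc w a && desc w b then f (simple a * (simple b * (simple a * w)))%g else 0.
Proof.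
move=> ab; rewrite /descop desc_braid //.
case: (boolP (desc w a)) => //= da; case: (boolP (desc w b)) => db; last by rewrite !if_same.
by rewrite desc_adjacent.
Qed.

Lemma nil_op_braid k f :
  nil_op k (nil_op k.+1 (nil_op k f)) = nil_op k.+1 (nil_op k (nil_op k.+1 f)).
Proof.
case: (ltnP k.+1 n.-1) => [jm|jm]; last by rewrite !(nil_op_default _ jm) linear0.
pose a := Ordinal (ltnW jm); pose b := Ordinal jm.
have ab : adjacent a b by rewrite /adjacent /= eqxx.
have E (c d : 'I_n.-1) w : nil_op c (nil_op d (nil_op c f)) w = descop c (descop d (descop c f)) w.
  by rewrite nil_opE /descop nil_opE /descop nil_opE.
apply/ffunP => w; apply: etrans (E a b w) (etrans _ (esym (E b a w))).
rewrite !descop_braid // 1?adjacentC //.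
by rewrite andbC !mulgA (simple_braid ab).
Qed.

Local Notation rowop := (hrow nil_op).
Local Notation fac := (factor nil_op).

Definition mpvar s : P := oapp (fun i : 'I_n => 'X_i) 0 (insub s).

Lemma varE (i : 'I_n) : mpvar i = 'X_i.
Proof. by rewrite /mpvar valK. Qed.

Definition unit_vec : V := [ffun w => (w == 1%g)%:R].

Fixpoint rows k : V :=
  if k is k'.+1 then rowop k' (n.-1 - k') (mpvar k') (rows k') else unit_vec.

Definition nil_factor x k f : V := fac k x f.

Lemma nil_factorE x k f w : nil_factor x k f w = f w + x * nil_op k f w.
Proof. by rewrite /nil_factor /factor !ffunE. Qed.

(** This puts a row into the order of the theorem: the innermost factor of [rowop], applied first,
    carries the largest index m - 1 and corresponds to i = 1. *)
Lemma row_foldl m x s d f : (s + d)%N = m ->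
  rowop s d x f = foldl (fun g i => nil_factor x (m - i) g) f (iota 1 d).
Proof.
elim: d s => [//|d IH] s sd; rewrite -[d.+1 in RHS]addn1 iotaD foldl_cat /= add1n.
rewrite -(IH s.+1); last by rewrite addSnnS.
by have -> : (m - d.+1)%N = s by rewrite -sd addnK.
Qed.

Definition sym_vec a f : V := [ffun w => msym (simple a) (f w)].

Fact sym_vecD a : {morph sym_vec a : f g / f + g}.
Proof. by move=> f g; apply/ffunP => w; rewrite !ffunE; apply: msymD. Qed.

Fact sym_vecZ a x f : sym_vec a (x *: f) = msym (simple a) x *: sym_vec a f.
Proof. by apply/ffunP => w; rewrite !ffunE; apply: msymM. Qed.

Fact sym_vec_nil a k f : sym_vec a (nil_op k f) = nil_op k (sym_vec a f).
Proof.
apply/ffunP => w; rewrite !ffunE; case: (insub k) => [b|] /=; last exact: msym0.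
by rewrite /descop; case: ifP => _; rewrite ?ffunE //; exact: msym0.
Qed.

Lemma msym_var a s : s != a -> s != a.+1 -> msym (simple a) (mpvar s) = mpvar s.
Proof.
move=> sa sa1; rewrite /mpvar; case: insubP => [i _ e|_] /=; last exact: msym0.
by rewrite msymXi /simple tpermD // -val_eqE /= eq_sym [i : nat]e.
Qed.

Lemma msym_var_lo a : msym (simple a) (mpvar a) = mpvar a.+1.
Proof. by rewrite (varE (adj_lo a)) (varE (adj_hi a)) msymXi simple_lo. Qed.

Lemma msym_var_hi a : msym (simple a) (mpvar a.+1) = mpvar a.
Proof. by rewrite (varE (adj_lo a)) (varE (adj_hi a)) msymXi simple_hi. Qed.

Lemma sym_rows a k : (k <= a)%N -> sym_vec a (rows k) = rows k.
Proof.
elim: k => [_|k IH ka] /=.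
  by apply/ffunP => w; rewrite !ffunE rmorph_nat.
rewrite (sigma_row (@sym_vecD a) (@sym_vecZ a) (@sym_vec_nil a)) IH ?(ltnW ka) //.
by rewrite msym_var //; move: ka; lia.
Qed.

(** The rows before a do not involve the two exchanged variables, rows a and a + 1 are treated by
    [row_ddiff], and all later rows have generators that commute with e_a. *)
Lemma ddiff_rows a k : (a.+1 < k)%N ->
  rows k - sym_vec a (rows k) = (mpvar a - mpvar a.+1) *: nil_op a (rows k).
Proof.
elim: k => // k IH; rewrite ltnS leq_eqVlt => /orP[/eqP <-|ak].
  have e : (n.-1 - a = (n.-1 - a.+1).+1)%N by have := ltn_ord a; lia.
  rewrite [rows _]/= e.
  apply: (row_ddiff nil_op_sq nil_op_far nil_op_braid (@sym_vecD a) (@sym_vecZ a) (@sym_vec_nil a)).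
  - exact: msym_var_lo.
  - exact: msym_var_hi.
  - exact: sym_rows.
apply: (ddiff_row nil_op_far (@sym_vecD a) (@sym_vecZ a) (@sym_vec_nil a) _ ak) (IH ak).
by apply: msym_var; lia.
Qed.

(** The row of index n - 1 is empty; counting it makes [ddiff_rows] apply to every a. *)
Definition schub_vec : V := rows n.

Lemma ddiff_schub_vec a w : ddiff a (schub_vec w) = descop a schub_vec w.
Proof.
apply: ddiff_uniq.
have an : (a.+1 < n)%N := adj_proof a.
have := congr1 (fun f : V => f w) (ddiff_rows an).
rewrite !ffunE valK /= => ->; rewrite (varE (adj_lo a)) (varE (adj_hi a)).
exact: mulrC.
Qed.

Lemma schub_vecE : schub_vec = rows n.-1.
Proof.
suff E k : k = n -> rows k = rows k.-1 by apply: E.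
by case: k => //= k e; have -> : (n.-1 - k = 0)%N by rewrite -e subnn.
Qed.

Lemma rows_ind (Q : V -> Prop) : Q unit_vec ->
  (forall k (i : 'I_n) f, Q f -> Q (fac k 'X_i f)) -> forall k, (k <= n)%N -> Q (rows k).
Proof.
move=> Q0 QS; elim=> [//|k IH] kn /=; have {IH} : Q (rows k) by apply: IH; apply: ltnW.
rewrite (varE (Ordinal kn)).
move: (Ordinal kn) (rows k) (n.-1 - k)%N => i f d Qf.
by elim: d {kn} k => //= d IH s; apply: QS.
Qed.

Lemma const_schub_vec w : const_term (schub_vec w) = (w == 1%g)%:R.
Proof.
apply: (@rows_ind (fun f => const_term (f w) = (w == 1%g)%:R)) => // [|k i f IH].
  by rewrite ffunE /const_term; case: eqP => _; rewrite ?rmorph1 ?rmorph0.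
rewrite /factor !ffunE /const_term mcoeffD -/(const_term _) IH rmorphM /=.
by rewrite mcoeffX mnm1_eq0 mul0r addr0.
Qed.

Lemma desc1 a : desc (1%g : 'S_n) a = false.
Proof. by rewrite /desc !perm1 /=; lia. Qed.

Lemma schub_vec1 : schub_vec 1%g = 1.
Proof.
apply: (@rows_ind (fun f => f 1%g = 1)) => // [|k i f IH]; first by rewrite ffunE eqxx.
rewrite /factor !ffunE IH; case: (insub k) => [a|] /=; last by rewrite scaler0 addr0.
by rewrite /descop desc1 scaler0 addr0.
Qed.

Definition top_term f w x := f w = x /\ forall u, (ninv w < ninv u)%N -> f u = 0.

(** Since f vanishes one step above the length of w, only the summand with x e_a reaches that
    length. *)
Lemma top_factor f w a x y : ~~ desc w a -> top_term f w y ->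
  top_term (fac a x f) (simple a * w)%g (x * y).
Proof.
move=> d [fw f0]; have iw := inv_asc d; split.
  by rewrite /factor ffunE f0 ?iw // add0r ffunE nil_opE /descop desc_simple d simple_mulK fw.
move=> u; rewrite iw => lu; rewrite /factor ffunE f0; last exact: ltnW.
rewrite add0r ffunE nil_opE /descop; case: ifP => du; last exact: scaler0.
by rewrite f0 ?scaler0 //; have := inv_desc du; lia.
Qed.

(* One-line notation after s full rows, and part of the next one: w carries the
   values n-1, n-2, ..., n-1-s at positions 0, ..., s-1, k and increases elsewhere. *)
Definition row_shape s k w := forall j : 'I_n,
  w j = (if j < s then n.-1 - j else if j < k then j - s
         else if j == k :> nat then n.-1 - s else j.-1 - s)%N :> nat.

(** Each factor of row s moves the value n - 1 - s one position to the left across a smaller value,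
    so it raises the length and contributes one power of x. *)
Lemma top_row s t d f w x y : (s <= t)%N -> (t + d)%N = n.-1 -> row_shape s n.-1 w -> top_term f w y ->
  exists2 w', row_shape s t w' & top_term (rowop t d x f) w' (x ^+ d * y).
Proof.
move=> + + sw tw; elim: d t => [|d IH] t st td /=.
  by exists w; [rewrite -td addn0 in sw | rewrite expr0 mul1r].
have [||w' sw' tw'] := IH t.+1; first exact: leqW; first by rewrite addSnnS.
have tm : (t < n.-1)%N by lia.
pose a := Ordinal tm.
exists (simple a * w')%g.
  move=> j; rewrite permM sw'.
  case: (tpermP _ _ j) => [->|->|/eqP + /eqP +]; rewrite -?val_eqE /=; do ?case: ifP; lia.
rewrite exprS -mulrA; apply: (@top_factor _ _ a) => //.
by rewrite /desc !sw' /=; do ?case: ifP; lia.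
Qed.

Lemma top_rows s : (s <= n.-1)%N -> exists2 w, row_shape s n.-1 w &
  top_term (rows s) w (\prod_(i < s) mpvar i ^+ (n.-1 - i)).
Proof.
elim: s => [_|s IH sm] /=.
  exists 1%g; first by move=> j; rewrite perm1; have := ltn_ord j; do ?case: ifP; lia.
  split; first by rewrite ffunE eqxx big_ord0.
  move=> u; rewrite inv1 ffunE; case: eqP => // ->; by rewrite inv1.
have [|w sw tw] := IH; first exact: ltnW.
have [w' sw' tw'] := top_row (mpvar s) (leqnn s) (subnKC (ltnW sm)) sw tw.
exists w'; last by rewrite big_ord_recr /= mulrC.
by move=> j; rewrite sw'; have := ltn_ord j; do ?case: ifP; lia.
Qed.

Lemma longest_desc a : desc (longest n) a.
Proof.
apply: contraT => d; rewrite /longest in d *.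
case: arg_maxnP d => // w _ max d.
by have := max (simple a * w)%g isT; rewrite /= !lenE inv_asc //; lia.
Qed.

(** Followed by the reversal, the longest element has no descent left, hence the composite is the
    identity. *)
Lemma longestE (j : 'I_n) : longest n j = rev_ord j.
Proof.
suff : (longest n * perm (@rev_ord_inj n))%g = 1%g.
  move/permP/(_ j); rewrite permM perm1 permE => /(congr1 (@rev_ord n)).
  by rewrite rev_ordK.
apply: asc_id => a; have := longest_desc a; rewrite /desc !permM !permE /=.
have := ltn_ord (longest n (adj_lo a)); lia.
Qed.

Lemma schub_vec_longest : schub_vec (longest n) = \prod_(i < n) 'X_i ^+ (n.-1 - i).
Proof.
rewrite schub_vecE; have [w sw [tw _]] := top_rows (leqnn n.-1).
have -> : longest n = w.
  apply/permP => j; apply: val_inj; rewrite longestE /= sw.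
  have := ltn_ord j; do ?case: ifP; lia.
(* The last variable has exponent 0 in the staircase monomial and no row of its own. *)
have E k (G : nat -> P) : G k.-1 = 1 -> \prod_(i < k.-1) G i = \prod_(i < k) G i.
  by case: k => [|k] /= Gk; rewrite ?big_ord0 // big_ord_recr /= Gk mulr1.
rewrite tw (E n (fun i => mpvar i ^+ (n.-1 - i))) ?subnn //.
by apply: eq_bigr => i _; rewrite varE.
Qed.

Lemma invV w : ninv (w^-1)%g = ninv w.
Proof.
rewrite /ninv -(card_imset (inversions w) (f := fun p => (w p.2, w p.1))); last first.
  by move=> [i j] [i' j'] [/perm_inj -> /perm_inj ->].
apply: eq_card => -[i j]; rewrite !inE /=; apply/idP/imsetP => [/andP[ij wij]|[[i' j']]].
  by exists ((w^-1)%g j, (w^-1)%g i); rewrite ?inE /= ?permKV ?ij ?wij.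
by rewrite inE /= => /andP[ij wij] [-> ->]; rewrite !permK ij wij.
Qed.

Lemma reduced_cons a r : reduced (a :: r) ->
  reduced r /\ ~~ desc (word_perm r)^-1%g a.
Proof.
rewrite /reduced /= -invV invMg /simple tpermV -/(simple a) inv_simple invV.
have := inv_word_le r; case: ifP => _ le1 /eqP e; first by lia.
by split=> //; apply/eqP; lia.
Qed.

(** Composition with the longest element turns ascents into descents, so no divided difference along
    a reduced word gives zero. *)
Lemma ddiffs_schub_vec r : reduced r ->
  ddiffs r (schub_vec (longest n)) = schub_vec ((word_perm r)^-1 * longest n)%g.
Proof.
elim: r => [|a r IH] red; first by rewrite invg1 mul1g.
have [red' d] := reduced_cons red; rewrite ddiffs_cons IH // ddiff_schub_vec /descop.
have -> : desc ((word_perm r)^-1 * longest n)%g a.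
  have := asc_lt d; rewrite /desc !permM !longestE /=.
  have := ltn_ord ((word_perm r)^-1%g (adj_hi a)); lia.
by rewrite /= invMg /simple tpermV -/(simple a) mulgA.
Qed.

Lemma schubertE w : schubert w = schub_vec w.
Proof.
rewrite /schubert /ddiff_perm -schub_vec_longest -/(ddiffs _ _).
by rewrite ddiffs_schub_vec ?redword_reduced // redwordE invMg invgK -mulgA mulVg mulg1.
Qed.

End FominStanley.

(** * Monk's rule and structure constants *)

Section StructureConstants.
Variable n : nat.
Local Notation P := {mpoly int[n]}.
Local Notation F := (schub_vec n).
Local Notation I := (@sym_ideal n).
Implicit Types (f g h : P) (u v w : 'S_n) (a b : 'I_n.-1) (i j : 'I_n) (r : seq 'I_n.-1).

Local Opaque ddiff.

Lemma ddiffs_rcons r a f : ddiffs (rcons r a) f = ddiffs r (ddiff a f).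
Proof. by rewrite -cats1 ddiffs_cat. Qed.

Lemma ddiffs0 r : ddiffs r (0 : P) = 0.
Proof. exact: (raddf0 (ddiffs r)). Qed.

Lemma ddiffs_schub_or r u :
  ddiffs r (F u) = 0 \/ ddiffs r (F u) = F ((word_perm r)^-1 * u)%g.
Proof.
elim: r => [|a r [IH|IH]]; first by right; rewrite invg1 mul1g.
  by left; rewrite ddiffs_cons IH; apply: (raddf0 (ddiff a)).
rewrite ddiffs_cons IH ddiff_schub_vec /descop; case: ifP => _; last by left.
by right; rewrite /= invMg /simple tpermV mulgA.
Qed.

Lemma ddiffs_schub_word r : reduced r -> ddiffs r (F (word_perm r)) = 1.
Proof.
elim/last_ind: r => [_|r a IH]; first exact: schub_vec1.
rewrite reduced_rcons => /andP[red asc].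
by rewrite ddiffs_rcons word_perm_rcons ddiff_schub_vec /descop desc_simple asc simple_mulK IH.
Qed.

(** The functional dual to [schubert w]: see [coef_schub] and [coef_ideal]. *)
Definition coef w f : int := const_term (ddiffs (redword w) f).

Lemma coefB w : {morph coef w : f g / f - g}.
Proof. by move=> f g; rewrite /coef ddiffsB /const_term mcoeffB. Qed.
HB.instance Definition _ w := GRing.isZmodMorphism.Build _ _ (coef w) (@coefB w).

Lemma coefZ w (k : int) f : coef w (k *: f) = k * coef w f.
Proof. by rewrite -[k in LHS]intz scaler_int raddfMz /= -mulrzl intz. Qed.

Lemma coef_schub w u : coef w (F u) = (u == w)%:R.
Proof.
case: eqP => [->|ne]; rewrite /coef.
  rewrite -{2}(redwordE w) ddiffs_schub_word ?redword_reduced //; exact: rmorph1.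
have [->|->] := ddiffs_schub_or (redword w) u; first exact: mcoeff0.
rewrite const_schub_vec redwordE; case: eqP => // e; case: ne.
by apply/esym/eqP; rewrite eq_mulVg1 e.
Qed.

Lemma coef_ideal w f : I f -> coef w f = 0.
Proof. by move=> If; apply/sym_ideal_const/sym_ideal_ddiffs. Qed.

Lemma coef_mod w f g : I (f - g) -> coef w f = coef w g.
Proof. by move=> If; apply/eqP; rewrite -subr_eq0 -coefB coef_ideal. Qed.

Definition killed f := forall r, const_term (ddiffs r f) = 0.

Lemma longestV : ((longest n)^-1 = longest n)%g.
Proof.
apply/eqP; rewrite eq_invg_mul; apply/eqP/permP => j.
by rewrite permM !longestE rev_ordK perm1.
Qed.

(** The longest element has a reduced word beginning with any given letter a, and a repeated divided
    difference vanishes. *)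
Lemma ddiff_ddiffs_longest a f : ddiff a (ddiffs (redword (longest n)) f) = 0.
Proof.
pose r := redword (longest n * simple a)%g.
have rE : word_perm (a :: r) = longest n.
  by rewrite /= redwordE -mulgA /simple tperm2 mulg1.
have red : reduced (a :: r).
  rewrite /reduced rE /= size_redword -(invV (longest n)) -invV invMg longestV.
  by rewrite /simple tpermV -/(simple a) -(inv_desc (longest_desc a)).
rewrite (ddiffs_reduced f (redword_reduced _) red) ?redwordE ?rE //.
by rewrite ddiffs_cons ddiff_ddiff.
Qed.

(** By induction on the degree all [ddiff a f] lie in the ideal. Hence f passes through the divided
    difference of the longest element: applied to f times the staircase monomial, it gives f modulo
    the ideal. The result is also symmetric, and its constant term is that of f, namely 0, so it
    lies in the ideal, and f with it. *)
Lemma killed_ideal f : killed f -> I f.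
Proof.
move: {2}(msize f) (leqnn (msize f)) => N; elim: N f => [|N IH] f fN kf.
  by move: fN; rewrite leqn0 msize_poly_eq0 => /eqP ->; apply: sym_ideal0.
have Id a : I (ddiff a f).
  have [->|nz] := eqVneq (ddiff a f) 0; first exact: sym_ideal0.
  apply: IH; first exact: leq_trans (msize_ddiff nz) fN.
  by move=> r; rewrite -ddiffs_rcons.
pose W := redword (longest n).
have := ddiffs_mulr_mod W (F (longest n)) Id.
have -> : ddiffs W (F (longest n)) = 1.
  by rewrite -[X in F X]redwordE ddiffs_schub_word // redword_reduced.
rewrite mul1r; set g := ddiffs W _ => Igf.
have Ig : I g.
  apply: sym_ideal_gen.
    by apply: ddiff0_symmetric => a; apply: ddiff_ddiffs_longest.
  have := sym_ideal_const Igf; rewrite /const_term mcoeffB -/(const_term f) (kf [::]).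
  by rewrite subr0.
by have := sym_idealB Ig Igf; rewrite opprB addrC subrK.
Qed.

Definition monk_defect i v := 'X_i * F v - monkop i F v.

Lemma ddiff_var a i : ddiff a 'X_i = ((i == adj_lo a)%:Z - (i == adj_hi a)%:Z)%:~R.
Proof.
apply: ddiff_uniq; rewrite msymXi /simple_root.
have [->|nlo] := eqVneq i (adj_lo a).
  by rewrite simple_lo adj_neq mul1r.
have [->|nhi] := eqVneq i (adj_hi a).
  by rewrite simple_hi mulN1r opprB.
by rewrite /simple tpermD 1?eq_sym // mul0r subrr.
Qed.

Lemma ddiff_monkop a i v : ddiff a (monkop i F v) = monkop i (descop a F) v.
Proof.
rewrite /monkop (raddf_sum (ddiff a)); apply: eq_bigr => j _.
by rewrite -ddiff_schub_vec; apply: (raddfMz (ddiff a)).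
Qed.

Lemma monk_defect_step (R : comNzRingType) (c : int) (X' f f' m m' : R) :
  m = m' + f *~ c -> (c%:~R * f + X' * f') - m = X' * f' - m'.
Proof. by move=> ->; rewrite mulrzl [m' + _]addrC opprD addrACA subrr add0r. Qed.

(** The Leibniz term cancels against the extra term of [monkop_descop], so defects are sent to
    defects or to 0. It then suffices to look at their constant terms. *)
Lemma ddiff_defect a i v :
  ddiff a (monk_defect i v) = descop a (monk_defect (simple a i)) v.
Proof.
rewrite /monk_defect ddiffB ddiffM ddiff_var msymXi ddiff_monkop ddiff_schub_vec.
rewrite (monk_defect_step _ _ (monkop_descop a i F v)).
rewrite /descop; case: ifP => _ //; by rewrite mulr0 subrr.
Qed.

Lemma killed_defect i v : killed (monk_defect i v).
Proof.
move=> r; elim/last_ind: r i v => [|r a IH] i v.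
  rewrite /= /monk_defect /const_term mcoeffB rmorphM /= mcoeffX mnm1_eq0 mul0r sub0r.
  apply/eqP; rewrite oppr_eq0 /monkop raddf_sum big1 //= => j /andP[_ /eqP cov].
  rewrite raddfMz /= -/(const_term _) const_schub_vec; case: eqP => [e|_].
    by rewrite e inv1 in cov.
  exact: mul0rz.
rewrite ddiffs_rcons ddiff_defect /descop; case: ifP => _; first exact: IH.
by rewrite ddiffs0; apply: mcoeff0.
Qed.

Lemma monk i v : I ('X_i * F v - monkop i F v).
Proof. exact/killed_ideal/killed_defect. Qed.

Definition spanned f := exists c : {ffun 'S_n -> int}, I (f - \sum_w c w *: schubert w).

Lemma spannedD f g : spanned f -> spanned g -> spanned (f + g).
Proof.
move=> [c hc] [d hd]; exists [ffun w => c w + d w].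
under eq_bigr do rewrite ffunE scalerDl.
by rewrite big_split opprD addrACA; apply: sym_idealD.
Qed.

Lemma spannedZ (k : int) f : spanned f -> spanned (k *: f).
Proof.
move=> [c hc]; exists [ffun w => k * c w].
under eq_bigr do rewrite ffunE -scalerA.
by rewrite -scaler_sumr -scalerBr -mul_mpolyC; apply: sym_idealMl.
Qed.

Lemma spannedMz (k : int) f : spanned f -> spanned (f *~ k).
Proof. by move=> h; rewrite -scaler_int; apply: spannedZ. Qed.

Lemma spanned_schub w : spanned (F w).
Proof.
exists [ffun u => (u == w)%:R].
rewrite (bigD1 w) //= big1 => [|u uw]; rewrite ffunE ?eqxx ?(negbTE uw) ?scale0r //.
by rewrite scale1r addr0 schubertE subrr; apply: sym_ideal0.
Qed.

Lemma spanned0 : spanned 0.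
Proof. by rewrite -(scale0r (F 1%g : P)); apply/spannedZ/spanned_schub. Qed.

Lemma spanned_mod f g : I (f - g) -> spanned g -> spanned f.
Proof.
move=> Ifg [c hc]; exists c; rewrite -[f](subrK g) -addrA.
exact: sym_idealD.
Qed.

Lemma spanned_sum (J : Type) (s : seq J) (Q : pred J) (G : J -> P) :
  (forall k, Q k -> spanned (G k)) -> spanned (\sum_(k <- s | Q k) G k).
Proof. by move=> h; apply: big_ind => //; [exact: spanned0|exact: spannedD]. Qed.

Lemma spanned_mulX i f : spanned f -> spanned ('X_i * f).
Proof.
move=> [c hc]; apply: (@spanned_mod _ ('X_i * \sum_w c w *: schubert w)).
  by rewrite -mulrBr; apply: sym_idealMl.
rewrite mulr_sumr; apply: spanned_sum => w _; rewrite -scalerAr schubertE; apply: spannedZ.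
apply: spanned_mod (monk i w) _; apply: spanned_sum => j _.
exact/spannedMz/spanned_schub.
Qed.

(** An expansion has to exist, as otherwise [xget] would return its default. Monomials are obtained
    from 1, the Schubert polynomial of the identity, by multiplying by variables, and Monk's rule
    keeps the span stable. *)
Lemma spannedT f : spanned f.
Proof.
rewrite [f]mpolyE; apply: spanned_sum => m _; apply: spannedZ.
pose Q (h : P) := forall g, spanned g -> spanned (h * g).
suff H : Q 'X_[m].
  by rewrite -[X in spanned X]mulr1; apply: H; rewrite -schub_vec1; apply: spanned_schub.
rewrite mpolyXE_id; apply: (@big_ind _ Q) => [|f1 f2 Q1 Q2|i _] g sg.
- by rewrite mul1r.
- by rewrite -mulrA; apply/Q1/Q2.
elim: (m i) g sg => [|k IH] g sg; first by rewrite expr0 mul1r.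
by rewrite exprS -mulrA; apply/spanned_mulX/IH.
Qed.

Lemma struct_constE u v w : struct_const u v w = coef w (F v * F u).
Proof.
rewrite /struct_const.
have [c hc] := spannedT (F u * F v).
case: classical_sets.xgetP => [d -> /= hd|/(_ c) []]; last by rewrite /= !schubertE.
have := coef_mod w hd; rewrite !schubertE mulrC => ->.
rewrite raddf_sum /= (bigD1 w) //= big1 => [|w' ne].
  by rewrite addr0 coefZ schubertE coef_schub eqxx mulr1.
by rewrite coefZ schubertE coef_schub (negbTE ne) mulr0.
Qed.

End StructureConstants.

(** * The nilCoxeter algebra *)

Section NilCoxeterWords.
Variables (n : nat) (N : pzRingType) (gen : 'I_n -> N).
Hypothesis gen_sq : forall a, gen a * gen a = 0.
Hypothesis gen_far : forall a b : 'I_n, far a b -> gen a * gen b = gen b * gen a.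
Hypothesis gen_adj : forall a b : 'I_n, adjacent a b ->
  gen a * gen b * gen a = gen b * gen a * gen b.
Implicit Types (a b : 'I_n) (v : 'S_n.+1) (r : seq 'I_n).

Definition nil_word r : N := \prod_(a <- r) gen a.

Lemma nil_word_rcons r a : nil_word (rcons r a) = nil_word r * gen a.
Proof. by rewrite /nil_word -cats1 big_cat big_seq1. Qed.

Lemma nil_word_reduced r r' : @reduced n.+1 r -> @reduced n.+1 r' ->
  @word_perm n.+1 r = @word_perm n.+1 r' -> nil_word r = nil_word r'.
Proof.
apply: (@matsumoto n.+1 _ nil_word) => {r r'} r a b r' ab;
  rewrite /nil_word !big_cat !big_cons /=; congr (_ * _).
  by rewrite !mulrA gen_far.
by rewrite !mulrA gen_adj.
Qed.

Definition nil_perm v : N := nil_word (redword v).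

Lemma nil_perm_asc v a : ~~ @desc n.+1 v a ->
  nil_perm v * gen a = nil_perm (@simple n.+1 a * v)%g.
Proof.
move=> d; rewrite /nil_perm -nil_word_rcons; apply: nil_word_reduced.
- by rewrite reduced_rcons redword_reduced redwordE.
- exact: redword_reduced.
- by rewrite word_perm_rcons !redwordE.
Qed.

Lemma nil_perm_desc v a : @desc n.+1 v a -> nil_perm v * gen a = 0.
Proof.
move=> d; rewrite -[v](@simple_mulK n.+1 a) -nil_perm_asc; last by rewrite desc_simple negbK.
by rewrite -mulrA gen_sq mulr0.
Qed.

Lemma nil_perm1 : nil_perm 1%g = 1.
Proof.
rewrite /nil_perm; have := size_redword (1%g : 'S_n.+1); rewrite inv1.
by move/eqP/nilP => ->; rewrite /nil_word big_nil.
Qed.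

(** The values of [a] and [adj_lo a] agree, so this is the inclusion of the index sets of the
    generators. *)
Definition letter (a : 'I_n.-1) : 'I_n := adj_lo a.

Definition nil_sym (v : 'S_n) : N := nil_perm (sym_incl v).

Lemma sym_inclM (v w : 'S_n) : sym_incl (v * w)%g = (sym_incl v * sym_incl w)%g.
Proof. by rewrite /sym_incl lift_permM. Qed.

Lemma sym_incl_lift (v : 'S_n) (i : 'I_n) : sym_incl v (lift ord_max i) = lift ord_max (v i).
Proof. exact: lift_perm_lift. Qed.

Lemma letter_lo (a : 'I_n.-1) : @adj_lo n.+1 (letter a) = lift ord_max (adj_lo a).
Proof. by apply: ord_inj; rewrite lift_max. Qed.

Lemma letter_hi (a : 'I_n.-1) : @adj_hi n.+1 (letter a) = lift ord_max (adj_hi a).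
Proof. by apply: ord_inj; rewrite lift_max. Qed.

Lemma desc_sym_incl (v : 'S_n) (a : 'I_n.-1) : @desc n.+1 (sym_incl v) (letter a) = desc v a.
Proof. by rewrite /desc letter_lo letter_hi !sym_incl_lift !lift_max. Qed.

Lemma sym_incl_simple (a : 'I_n.-1) : sym_incl (simple a) = @simple n.+1 (letter a).
Proof.
apply/permP => i; rewrite /simple letter_lo letter_hi.
case: (unliftP ord_max i) => [j|] ->.
  rewrite sym_incl_lift; case: (tpermP _ _ j) => [->|->|/eqP n1 /eqP n2].
  - by rewrite tpermL.
  - by rewrite tpermR.
  - by rewrite tpermD // (inj_eq lift_inj) eq_sym.
by rewrite /sym_incl lift_perm_id tpermD // eq_sym neq_lift.
Qed.

Lemma nil_sym1 : nil_sym 1 = 1.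
Proof. by rewrite /nil_sym /sym_incl lift_perm1 nil_perm1. Qed.

Lemma nil_sym_gen (v : 'S_n) (a : 'I_n.-1) :
  nil_sym v * gen (letter a) = if desc v a then 0 else nil_sym (simple a * v)%g.
Proof.
case: ifP => d; first by rewrite nil_perm_desc // desc_sym_incl.
by rewrite nil_perm_asc ?desc_sym_incl ?d // /nil_sym sym_inclM sym_incl_simple.
Qed.

(** * Extracting the coefficient of one Schubert polynomial *)

Section Pairing.
Implicit Types u w : 'S_n.
Local Notation P := {mpoly int[n]}.
Local Notation F := (schub_vec n).
Variable w : 'S_n.

(* The coefficient of schubert w in the product of schubert u with the element
   \sum_v f v *: e_v of the nilCoxeter algebra over P. *)
Definition pairing (f : 'S_n -> P) (u : 'S_n) : N :=
  \sum_(v : 'S_n) nil_sym v *~ coef w (f v * F u).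

Lemma pairing_unit u : pairing (fun v : 'S_n => (v == 1%g)%:R) u = (u == w)%:R.
Proof.
rewrite /pairing (bigD1 1%g) //= big1 => [|v v1].
  by rewrite eqxx mul1r coef_schub nil_sym1 addr0; case: eqP.
by rewrite (negbTE v1) mul0r raddf0.
Qed.

Lemma coef_monk (g : P) i u :
  coef w (g * ('X_i * F u)) = \sum_(j | covers i j u) coef w (g * F (tperm i j * u)%g) *~ isign i j.
Proof.
rewrite (@coef_mod _ w _ (g * monkop i F u)).
  rewrite /monkop mulr_sumr raddf_sum; apply: eq_bigr => j _.
  by rewrite mulrzAr raddfMz.
by rewrite -mulrBr; apply/sym_idealMl/monk.
Qed.

(** Reindexing by v s_a moves the descent operator from f onto the elements e_v, where it is right
    multiplication by e_a. *)
Lemma sum_descop (a : 'I_n.-1) (f : 'S_n -> P) (g : P) :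
  \sum_(v : 'S_n) nil_sym v *~ coef w (descop a f v * g) =
  (\sum_(v : 'S_n) nil_sym v *~ coef w (f v * g)) * gen (letter a).
Proof.
rewrite mulr_suml (reindex_inj (mulgI (simple a))) /=; apply: eq_bigr => v _.
rewrite mulrzAl nil_sym_gen /descop desc_simple simple_mulK.
by case: (desc v a) => /=; rewrite ?mul0r ?raddf0 ?mul0rz.
Qed.

(** Multiplication of f by 1 + x_i e_a: Monk's rule spends x_i on replacing u by its covers, and e_a
    comes out on the right. *)
Lemma pairing_factor (a : 'I_n.-1) (i : 'I_n) (f f' : 'S_n -> P) u :
  (forall v : 'S_n, f' v = f v + 'X_i * descop a f v) ->
  pairing f' u = pairing f u +
    (\sum_(j | covers i j u) pairing f (tperm i j * u)%g *~ isign i j) * gen (letter a).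
Proof.
move=> f'E.
have E (v : 'S_n) : coef w (f' v * F u) = coef w (f v * F u) +
    \sum_(j | covers i j u) coef w (descop a f v * F (tperm i j * u)%g) *~ isign i j.
  by rewrite f'E mulrDl raddfD /= -coef_monk mulrCA mulrA.
rewrite /pairing; under eq_bigr do rewrite E mulrzDr.
rewrite big_split /=; congr (_ + _); under eq_bigr do rewrite mulrz_sumr.
rewrite exchange_big mulr_suml /=; apply: eq_bigr => j _.
by rewrite mulrzAl -sum_descop mulrz_suml; apply: eq_bigr => v _; rewrite mulrzz mulrzA.
Qed.

(** Here [cut] is the column u of a matrix with 1 on the diagonal and signed generators at the
    covers, so one matrix step reproduces the right-hand side of [pairing_factor]. *)
Lemma sum_cut (cut : 'S_n -> N) (G : 'S_n -> N) a (i : 'I_n) u : cut u = 1 ->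
  (forall u', u' != u ->
    cut u' = \sum_(j | covers i j u && (tperm i j * u == u')%g) gen a *~ isign i j) ->
  \sum_q G q * cut q =
  G u + (\sum_(j | covers i j u) G (tperm i j * u)%g *~ isign i j) * gen a.
Proof.
move=> cut1 cutE; rewrite (bigD1 u) //= cut1 mulr1; congr (_ + _).
transitivity (\sum_(q | q != u) \sum_(j | covers i j u && (tperm i j * u == q)%g)
   (G q * gen a) *~ isign i j).
  apply: eq_bigr => q qu; rewrite (cutE _ qu) mulr_sumr.
  by apply: eq_bigr => j _; rewrite mulrzAr.
rewrite mulr_suml (exchange_big_dep (fun j => covers i j u)) /=; last by move=> q j _ /andP[].
apply: eq_bigr => j cj; rewrite mulrzAl (big_pred1 (tperm i j * u)%g) // => q.
rewrite cj /= [RHS]eq_sym; case: ((tperm i j * u)%g =P q) => [<-|_]; last by rewrite andbF.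
rewrite andbT; apply/eqP => e; case/andP: cj => _; rewrite e; lia.
Qed.

End Pairing.
End NilCoxeterWords.

Section NilCoxeter.
Variable n : nat.
Implicit Types (a b : 'I_n).
Local Notation gen := (@nc_gen n).

Lemma nc_relP (x y : free_alg n) : nc_relator (x - y) ->
  quot_pi (@nc_relator n) x = quot_pi (@nc_relator n) y.
Proof.
move=> h; apply/quot_piP; exists [:: (1, x - y, 1)]; last by rewrite big_seq1 mul1r mulr1.
by move=> t; rewrite inE => /eqP ->.
Qed.

Lemma quot_pi_mul (x y : free_alg n) : quot_pi (@nc_relator n) x * quot_pi (@nc_relator n) y =
  quot_pi (@nc_relator n) (x * y).
Proof. by rewrite quot_piM. Qed.

Lemma quot_pi_mul3 (x y z : free_alg n) :
  quot_pi (@nc_relator n) x * quot_pi (@nc_relator n) y * quot_pi (@nc_relator n) z =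
  quot_pi (@nc_relator n) (x * y * z).
Proof. exact: etrans (congr1 ( *%R^~ _) (quot_pi_mul x y)) (quot_pi_mul _ _). Qed.

Lemma nc_gen_sq a : gen a * gen a = 0.
Proof.
have h : nc_relator (free_gen a * free_gen a - 0) by rewrite subr0; apply: NcSquare.
exact: etrans (quot_pi_mul _ _) (etrans (nc_relP h) (raddf0 _)).
Qed.

Lemma nc_gen_far a b : far a b -> gen a * gen b = gen b * gen a.
Proof.
move=> h; exact: etrans (quot_pi_mul _ _) (etrans (nc_relP (NcCommute h)) (esym (quot_pi_mul _ _))).
Qed.

Lemma nc_gen_adj a b : adjacent a b -> gen a * gen b * gen a = gen b * gen a * gen b.
Proof.
move=> h; exact: etrans (quot_pi_mul3 _ _ _) (etrans (nc_relP (NcBraid h)) (esym (quot_pi_mul3 _ _ _))).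
Qed.

(** Setting the entry to zero at pairs that violate the step condition turns the constrained sum
    over families into a product of matrices. *)
Definition nc_cut i s (u v : 'S_n) : nilcoxeter n :=
  if step_rel u v then nc_step i s u v else 0.

Lemma step_rel_refl (u : 'S_n) : step_rel u u.
Proof.
have sz : size (redword u) == len u by rewrite size_redword lenE.
rewrite /step_rel subnn andbT; apply/existsP; exists (Tuple sz); apply/existsP; exists (Tuple sz).
by rewrite /= redwordE eqxx subseq_refl.
Qed.

(** A transposition that moves i0 and leads from u to u' is determined by these two, so the sum has
    at most one term, whose sign selects the branch of [nc_step]. *)
Lemma nc_cutE (a : 'I_n.-1) (i0 : 'I_n) i (u u' : 'S_n) : (n - i)%N = a.+1 -> u' != u ->
  nc_cut i i0.+1 u' u =
  \sum_(j | covers i0 j u && (tperm i0 j * u == u')%g) gen (letter a) *~ isign i0 j.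
Proof.
move=> ia ne; rewrite /nc_cut /nc_step (negbTE ne) ia.
have -> : nc_e n a.+1 = gen (letter a).
  by rewrite /= (insubT (fun k => k < n)%N (ltnW (adj_proof a))); congr gen; apply: val_inj.
have uniq j j' : (tperm i0 j * u)%g = (tperm i0 j' * u)%g -> j = j'.
  by move/mulIg/permP/(_ i0); rewrite !tpermL.
have [/existsP[j /andP[cj /eqP ju]]|none] :=
    boolP [exists j, covers i0 j u && (tperm i0 j * u == u')%g].
  rewrite (big_pred1 j) => [|k]; last first.
    apply/idP/eqP => [/andP[_ /eqP]|->]; last by rewrite cj ju eqxx.
    by rewrite -ju => /uniq.
  case/andP: cj => ij cj; rewrite -ju step_rel_tperm // cj /isign.
  have [lt|ge] := ltnP i0 j.
    case: existsP => [//|[]]; exists i0; apply/existsP; exists j.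
    by rewrite !eqxx lt.
  case: existsP => [[a0 /existsP[b /and3P[/eqP[a0E] ab /eqP e]]]|_].
    have a0i : a0 = i0 by apply: val_inj.
    by move: e ab; rewrite a0i => /uniq <-; lia.
  case: existsP => [_|[]]; first by [].
  exists i0; apply/existsP; exists j; rewrite eqxx tpermC eqxx andbT /=.
  by move: ij ge; rewrite -val_eqE /=; lia.
rewrite big_pred0 => [|j]; last first.
  by apply/negbTE; apply: contra none => h; apply/existsP; exists j.
case: ifP => // st.
(* In the remaining branches, the step condition would make such a transposition a cover, which has
   been excluded. *)
have no b : i0 != b -> (u' == tperm i0 b * u)%g = false.
  move=> ib; apply/negbTE; apply: contra none => /eqP e; apply/existsP; exists b.
  by rewrite /covers ib e eqxx andbT /= -step_rel_tperm // -e.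
case: existsP => [[a0 /existsP[b /and3P[/eqP[a0E] ab]]]|_].
  have -> : a0 = i0 by apply: val_inj.
  by rewrite no //; move: ab a0E; rewrite -val_eqE /=; lia.
case: existsP => [[a0 /existsP[b /and3P[/eqP[a0E] ab]]]|_ //].
have -> : a0 = i0 by apply: val_inj.
by rewrite tpermC no //; move: ab a0E; rewrite -val_eqE /=; lia.
Qed.

End NilCoxeter.

(** * Chains *)

Section Paths.
Variables (N : pzRingType) (S : finType) (w : S).
Implicit Types (T : nat -> S -> S -> N) (G : S -> N).

Definition transfer G (C : S -> S -> N) : S -> N := fun u => \sum_q G q * C q u.

Lemma lift_max_inord k K : (k < K.+1)%N -> lift ord_max (inord k : 'I_K.+1) = inord k :> 'I_K.+2.
Proof. by move=> kK; apply: ord_inj; rewrite lift_max !inordK // ltnW. Qed.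

(** Expansion of a matrix product over paths. The last matrix is split off, which respects the order
    of the noncommuting entries; [h] below appends the endpoint u. *)
Lemma sum_paths T K u :
  \sum_(p : {ffun 'I_K.+1 -> S} | (p ord0 == w) && (p ord_max == u))
     \prod_(k < K) T k (p (inord k)) (p (inord k.+1)) =
  foldl transfer (fun u => (u == w)%:R) [seq T k | k <- iota 0 K] u.
Proof.
elim: K u => [|K IH] u.
  rewrite /= (ord1 ord_max).
  under eq_bigr do rewrite big_ord0.
  case: eqP => [->|ne].
    rewrite (big_pred1 [ffun => w]) // => p; rewrite andbb /=.
    by apply/eqP/eqP => [e|->]; [apply/ffunP => i; rewrite ord1 ffunE|rewrite ffunE].
  by rewrite big_pred0 // => p; apply/negP => /andP[/eqP e1 /eqP e2]; case: ne; rewrite -e1 -e2.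
rewrite -[K.+1]addn1 iotaD map_cat foldl_cat /= {2}/transfer -/(iota 0 K) addn1 add0n.
pose h (p : {ffun 'I_K.+1 -> S}) : {ffun 'I_K.+2 -> S} :=
  [ffun i => if unlift ord_max i is Some j then p j else u].
pose h' (p : {ffun 'I_K.+2 -> S}) : {ffun 'I_K.+1 -> S} := [ffun j => p (lift ord_max j)].
have hl p j : h p (lift ord_max j) = p j by rewrite ffunE liftK.
have hm p : h p ord_max = u by rewrite ffunE unlift_none.
have h0 p : h p ord0 = p ord0.
  by have -> : ord0 = lift ord_max (ord0 : 'I_K.+1) :> 'I_K.+2 by [apply: ord_inj; rewrite lift_max]; rewrite hl.
have hi p k : (k < K.+1)%N -> h p (inord k) = p (inord k).
  by move=> kK; rewrite -lift_max_inord // hl.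
rewrite (reindex_onto h h') /=; last first.
  move=> p /andP[_ /eqP pu]; apply/ffunP => i; rewrite ffunE.
  by case: unliftP => [j|] ->; rewrite ?ffunE // pu.
rewrite (partition_big (fun p : {ffun 'I_K.+1 -> S} => p ord_max) xpredT) //=.
apply: eq_bigr => q _; rewrite -IH mulr_suml; apply: eq_big => [p|p].
  rewrite h0 hm eqxx andbT; congr (_ && _); rewrite andb_idr // => _.
  by apply/eqP/ffunP => j; rewrite ffunE hl.
case/andP=> _ /eqP pq; rewrite big_ord_recr /=; congr (_ * _).
  by apply: eq_bigr => k _; rewrite !hi //; have := ltn_ord k; lia.
rewrite hi //; have -> : inord K = ord_max :> 'I_K.+1 by apply: ord_inj; rewrite inordK.
have -> : inord K.+1 = ord_max :> 'I_K.+2 by apply: ord_inj; rewrite inordK.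
by rewrite hm pq.
Qed.

End Paths.

Lemma foldl_map (A B C : Type) (g : A -> B) (h : C -> B -> C) (c : C) (s : seq A) :
  foldl h c (map g s) = foldl (fun c a => h c (g a)) c s.
Proof. by elim: s c => /=. Qed.

(** * Families of permutations as paths *)

Section Chains.
Variable n : nat.
Implicit Types (s i k m : nat) (st : nat * nat).

Definition steps m : seq (nat * nat) :=
  flatten [seq [seq (s, i) | i <- iota 1 (n - s)] | s <- iota 1 m].

Lemma stepsS m : steps m.+1 = steps m ++ [seq (m.+1, i) | i <- iota 1 (n - m.+1)].
Proof. by rewrite /steps -{1}[m.+1]addn1 iotaD map_cat flatten_cat /= cats0 add1n. Qed.

Definition offset s := (\sum_(1 <= t < s) (n - t))%N.
(** The pairs (s, n - s) and (s + 1, 0) have the same position, so the gluing condition says that a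
    family is a function of the position. *)
Definition position st := (offset st.1 + st.2)%N.

Lemma offsetS s : (0 < s)%N -> offset s.+1 = (offset s + (n - s))%N.
Proof. by move=> s0; rewrite /offset big_nat_recr. Qed.

Lemma map_position m : [seq position st | st <- steps m] = iota 1 (offset m.+1).
Proof.
elim: m => [|m IH]; first by rewrite /offset big_geq.
rewrite stepsS map_cat IH [offset m.+2]offsetS // iotaD; congr (_ ++ _).
by rewrite -map_comp /position /= addnC iotaDl.
Qed.

Lemma mem_steps m s i : ((s, i) \in steps m) = [&& 0 < s, s <= m, 0 < i & i <= n - s]%N.
Proof.
elim: m => [|m IH]; first by rewrite /= in_nil; lia.
rewrite stepsS mem_cat IH.
have -> : ((s, i) \in [seq (m.+1, i) | i <- iota 1 (n - m.+1)]) =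
    [&& s == m.+1, 0 < i & i <= n - s]%N.
  apply/mapP/idP => [[j]|/and3P[/eqP -> i0 im]].
    by rewrite mem_iota => h [-> ->]; rewrite eqxx; move: h; lia.
  by exists i; rewrite // mem_iota; lia.
lia.
Qed.

Lemma prod_steps (N : pzRingType) (G : nat -> nat -> N) :
  \prod_(1 <= s < n) \prod_(1 <= i < (n - s).+1) G s i = \prod_(st <- steps n.-1) G st.1 st.2.
Proof.
rewrite /steps big_flatten big_map /index_iota subn1; apply: eq_bigr => s _.
by rewrite big_map /= subn1.
Qed.

Lemma entryE (f : chain n) (x : chain_index n) : entry f (val x).1 (val x).2 = f x.
Proof.
rewrite /entry; case: pickP => [y /andP[/eqP e1 /eqP e2]|/(_ x)]; last by rewrite !eqxx.
congr (f _); apply: val_inj; case: (val y) (val x) e1 e2 => [y1 y2] [x1 x2] /= e1 e2.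
by congr (_, _); apply: ord_inj.
Qed.

Lemma chain_indexP s i : (0 < s < n)%N -> (i <= n - s)%N ->
  exists x : chain_index n, (val x).1 = s :> nat /\ (val x).2 = i :> nat.
Proof.
move=> /andP[s0 sn] ins; have iN : (i < n)%N by lia.
have h : (0 < (Ordinal sn, Ordinal iN).1)%N && ((Ordinal sn, Ordinal iN).2 <= n - (Ordinal sn, Ordinal iN).1)%N.
  by rewrite /= s0.
by exists (Sub (Ordinal sn, Ordinal iN) h).
Qed.

Hypothesis hn : (2 <= n)%N.
Local Notation L := (steps n.-1).
Local Notation K := (size L).

Lemma size_steps : K = offset n.
Proof. by rewrite -(size_map position) map_position size_iota prednK // ltnW. Qed.

Definition chain_of (p : {ffun 'I_K.+1 -> 'S_n}) : chain n :=
  [ffun x : chain_index n => p (inord (offset (val x).1 + (val x).2))].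

(** Of two pairs sharing a position the one with positive i is chosen; only position 0 is
    represented by i = 0. *)
Definition unposition k := if k is k'.+1 then nth (1, 0)%N L k' else (1, 0)%N.

Definition path_of (f : chain n) : {ffun 'I_K.+1 -> 'S_n} :=
  [ffun k : 'I_K.+1 => entry f (unposition k).1 (unposition k).2].

Lemma position_nth k : (k < K)%N -> position (nth (1, 0)%N L k) = k.+1.
Proof.
move=> kK; rewrite -(nth_map _ 0%N) // map_position nth_iota ?add1n //.
by rewrite -(size_iota 1 (offset _)) -map_position size_map.
Qed.

Lemma unpositionK k : (k <= K)%N -> position (unposition k) = k.
Proof. by case: k => [_|k]; [rewrite /position /= /offset big_geq|apply: position_nth]. Qed.

Lemma positionK st : st \in L -> unposition (position st) = st.
Proof.
move=> stL; have h : (index st L < K)%N by rewrite index_mem.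
have := position_nth h; rewrite nth_index // => -> /=.
by rewrite nth_index.
Qed.

Lemma position_le st : st \in L -> (0 < position st <= K)%N.
Proof.
move=> stL; have h : (index st L < K)%N by rewrite index_mem.
by have := position_nth h; rewrite nth_index // => ->.
Qed.

Lemma unposition_valid k : (k <= K)%N ->
  (0 < (unposition k).1 < n)%N /\ ((unposition k).2 <= n - (unposition k).1)%N.
Proof.
case: k => [|k] kK /=; first by split=> //; lia.
have := mem_nth (1, 0)%N kK; case: nth => s i; rewrite mem_steps /=; lia.
Qed.

Lemma entry_chain_of p s i : (0 < s < n)%N -> (i <= n - s)%N ->
  entry (chain_of p) s i = p (inord (position (s, i))).
Proof.
by move=> hs hi; have [x [<- <-]] := chain_indexP hs hi; rewrite entryE ffunE.
Qed.

Lemma chain_ofK p : path_of (chain_of p) = p.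
Proof.
apply/ffunP => k; have kK : (k <= K)%N by rewrite -ltnS.
have [h1 h2] := unposition_valid kK.
rewrite ffunE entry_chain_of // -surjective_pairing unpositionK //.
by rewrite inord_val.
Qed.

(** Only the entries (s + 1, 0) with s positive are missing from the path, and gluing recovers them
    from (s, n - s). *)
Lemma path_ofK u w f : admissible u w f -> chain_of (path_of f) = f.
Proof.
case/and4P=> _ /forallP glue _ _; apply/ffunP => x; rewrite ffunE -entryE.
case: x => -[[s sn] [i iN]] /= h; rewrite -/(position (s, i)).
have {h} [s0 ins] := andP h; rewrite /= in s0 ins.
case: i iN ins => [|i] iN ins; last first.
  have stL : (s, i.+1) \in L by rewrite mem_steps; lia.
  by rewrite ffunE inordK ?positionK // ltnS; case/andP: (position_le stL).
case: s sn s0 ins => [//|[|s]] sn _ _.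
  by rewrite /position /offset big_geq //= ffunE inordK.
have stL : (s.+1, n - s.+1)%N \in L by rewrite mem_steps; lia.
have -> : position (s.+2, 0)%N = position (s.+1, n - s.+1)%N.
  by rewrite /position /= addn0 offsetS.
rewrite ffunE inordK ?positionK ?ltnS //; last by case/andP: (position_le stL).
have := glue (Ordinal (ltnW sn)); rewrite /=.
have -> : (s < n - 2)%N by lia.
by move/eqP.
Qed.

Lemma admissible_chain_of u w p : admissible u w (chain_of p) =
  [&& p ord0 == w, p ord_max == u &
      all (fun st => step_rel (p (inord (position st).-1)) (p (inord (position st)))) L].
Proof.
have e0 : entry (chain_of p) 1 0 = p ord0.
  rewrite entry_chain_of //.
  by congr (p _); apply: ord_inj; rewrite /position /offset big_geq // inordK.
have e1 : entry (chain_of p) n.-1 1 = p ord_max.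
  rewrite entry_chain_of //; try lia.
  (* The row n - 1 has a single factor, so (n - 1, 1) is the end of the path. *)
  have posK : position (n.-1, 1)%N = K.
    have := @offsetS n.-1; rewrite size_steps prednK /position /=; last exact: ltnW.
    by move=> ->; lia.
  by congr (p _); apply: ord_inj; rewrite posK inordK.
rewrite /admissible e0 e1; congr (_ && _).
have -> /= : [forall s : 'I_n, (1 <= s <= n - 2)%N ==>
    (entry (chain_of p) s.+1 0 == entry (chain_of p) s (n - s))].
  apply/forallP => s; apply/implyP => hs; rewrite !entry_chain_of //; try lia.
  by rewrite /position /= addn0 offsetS //; lia.
congr (_ && _); apply/forallP/allP => [h [s i] stL|h s].
  have := stL; rewrite mem_steps => v.
  have sn : (s < n)%N by lia.
  have iN : (i < n)%N by lia.
  have := forallP (h (Ordinal sn)) (Ordinal iN) => /implyP /=.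
  rewrite !entry_chain_of; try lia.
  have -> : (position (s, i)).-1 = position (s, i.-1) by rewrite /position /=; lia.
  by apply; lia.
apply/forallP => i; apply/implyP => v.
have stL : (nat_of_ord s, nat_of_ord i) \in L by rewrite mem_steps; have := ltn_ord s; lia.
have := h _ stL; have := ltn_ord s => sn; rewrite !entry_chain_of; try lia.
by have -> : (position (nat_of_ord s, nat_of_ord i)).-1 = position (nat_of_ord s, i.-1) by rewrite /position /=; lia.
Qed.

Lemma prod_cut (N : pzRingType) (J : eqType) (s : seq J) (B : pred J) (G : J -> N) :
  \prod_(j <- s) (if B j then G j else 0) = if all B s then \prod_(j <- s) G j else 0.
Proof.
elim: s => [|j s IH] /=; first by rewrite !big_nil.
by rewrite !big_cons IH; case: (B j) => /=; rewrite ?mul0r //; case: ifP => _; rewrite ?mulr0.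
Qed.

Lemma sum_chains u w :
  \sum_(f : chain n | admissible u w f)
      \prod_(1 <= s < n) \prod_(1 <= i < (n - s).+1)
        nc_step i s (entry f s i.-1) (entry f s i) =
  foldl (@transfer (nilcoxeter n) _) (fun u => (u == w)%:R) [seq nc_cut st.2 st.1 | st <- L] u.
Proof.
have -> : [seq @nc_cut n st.2 st.1 | st <- L] =
    [seq nc_cut (nth (1, 0)%N L k).2 (nth (1, 0)%N L k).1 | k <- iota 0 K].
  by rewrite -{1}(mkseq_nth (1, 0)%N L) /mkseq -map_comp.
rewrite -sum_paths (reindex_onto chain_of path_of); last by move=> f /path_ofK.
under eq_bigl do rewrite chain_ofK eqxx andbT admissible_chain_of andbA.
rewrite big_mkcondr; apply: eq_bigr => p _.
pose G st := nc_step st.2 st.1 (p (inord (position st).-1)) (p (inord (position st))).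
have -> : \prod_(1 <= s < n) \prod_(1 <= i < (n - s).+1)
    nc_step i s (entry (chain_of p) s i.-1) (entry (chain_of p) s i) = \prod_(st <- L) G st.
  rewrite (prod_steps (fun s i => nc_step i s (entry (chain_of p) s i.-1) (entry (chain_of p) s i))).
  apply: eq_big_seq => -[s i] stL; rewrite /G /=.
  have := stL; rewrite mem_steps => v; rewrite !entry_chain_of; try lia.
  by have -> : (position (s, i)).-1 = position (s, i.-1) by rewrite /position /=; lia.
rewrite -prod_cut (big_nth (1, 0)%N) big_mkord; apply: eq_bigr => k _.
by rewrite /nc_cut /G position_nth.
Qed.

Definition step_factor f st := nil_factor (mpvar n st.1.-1) (n.-1 - st.2) f.

Lemma rows_steps m : (m <= n.-1)%N -> rows n m = foldl step_factor (unit_vec n) (steps m).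
Proof.
elim: m => [//|m IH] mn; rewrite stepsS foldl_cat -IH; last exact: ltnW.
rewrite /= (row_foldl _ _ (subnKC (ltnW mn))) foldl_map.
by have -> : (n.-1 - m = n - m.+1)%N by lia.
Qed.

(** Each matrix on the left matches one factor 1 + x_s e_(n-i) on the right, where Monk's rule
    performs the step. Allowing any list of valid pairs lets the induction remove the last one. *)
Lemma foldl_pairing u w Ls : {subset Ls <= L} ->
  foldl (@transfer (nilcoxeter n) _) (fun u => (u == w)%:R) [seq nc_cut st.2 st.1 | st <- Ls] u =
  pairing (@nc_gen n) w (foldl step_factor (unit_vec n) Ls) u.
Proof.
elim/last_ind: Ls u => [|Ls [s i] IH] u sub.
  rewrite /= -(pairing_unit (@nc_gen n)) /pairing; apply: eq_bigr => v _.
  by rewrite ffunE.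
have stL : (s, i) \in L by apply: sub; rewrite mem_rcons mem_head.
rewrite map_rcons !foldl_rcons /=; have := stL; rewrite mem_steps => v.
(* Counted from 0, the generator e_(n-i) has index n - 1 - i and the variable x_s has index s -
   1. *)
have an : (n.-1 - i < n.-1)%N by lia.
pose a := Ordinal an.
have sn : (s.-1 < n)%N by lia.
pose i0 := Ordinal sn.
have s0 : s = i0.+1 by rewrite /=; lia.
have ia : (n - i)%N = a.+1 by rewrite /=; lia.
rewrite (pairing_factor (@nc_gen_sq n) (@nc_gen_far n) (@nc_gen_adj n) w (a := a) (i := i0)
  (f := foldl step_factor (unit_vec n) Ls)); last first.
  by move=> x; rewrite /step_factor nil_factorE (nil_opE a) /= (varE i0).
rewrite -(sum_cut (gen := @nc_gen n) (cut := nc_cut i s ^~ u)).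
- by apply: eq_bigr => q _; rewrite IH // => x xL; apply: sub; rewrite mem_rcons inE xL orbT.
- by rewrite /nc_cut step_rel_refl /nc_step eqxx.
- by move=> u' ne; rewrite s0; apply: nc_cutE.
Qed.

End Chains.

Theorem theorem2 (n : nat) (hn : (2 <= n)%N) (u w : 'S_n) :
  \sum_(v : 'S_n) nc_perm (sym_incl v) *~ struct_const u v w
  = \sum_(f : chain n | admissible u w f)
      \prod_(1 <= s < n) \prod_(1 <= i < (n - s).+1)
        nc_step i s (entry f s i.-1) (entry f s i).
Proof.
rewrite sum_chains // foldl_pairing // -rows_steps // -schub_vecE.
by apply: eq_bigr => v _; rewrite struct_constE.
Qed.
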